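(* Let $L$ be an object in the category of graded connected pre-Lie algebras over $K$. The following are equivalent: (a) $L$ is a non-associative permutative coalgebra satisfying the compatibility relation, i.e. $L$ can be equipped with a non-associative permutative coproduct $\Delta:L\to L\otimes L$ such that $\Delta(x\circ y)=x\otimes y+\Delta(x)\circ y$ for all $x,y\in L$; (b) $L$ is free as a graded pre-Lie algebra; (c) $L$ is an abelian cogroup in the category of graded connected pre-Lie algebras, i.e. $L$ can be equipped with an abelian cogroup structure.
   Context: $K$ is a field of characteristic $0$. A (right) pre-Lie algebra is a vector space $L$ with a bilinear product $\circ$ such that $(x\circ y)\circ z-x\circ(y\circ z)=(x\circ z)\circ y-x\circ(z\circ y)$. For $y\in L$, $(x_1\otimes x_2)\circ y=(x_1\circ y)\otimes x_2+x_1\otimes(x_2\circ y)$; this is the meaning of $\Delta(x)\circ y$. Graded connected means $L=\bigoplus_{n\ge1}L_n$ (degree $0$ part zero) with product preserving degree; all structure maps (products, coproducts, cogroup maps) are degree preserving, and all identities are taken as written, without signs. ''Free'' means isomorphic to the free pre-Lie algebra on some graded vector space concentrated in positive degrees. A non-associative permutative coproduct on $C$ is a linear map $\Delta:C\to C\otimes C$ with $(\mathrm{Id}-\tau_{23})(\Delta\otimes\mathrm{Id})\Delta=0$, where $\tau_{23}$ exchanges the last two factors of $C^{\otimes3}$. For two pre-Lie algebras $A,B$, $A\vee B$ denotes their categorical coproduct: the quotient of the free pre-Lie algebra on $A\oplus B$ by the ideal generated by the relations identifying the free product of two elements of $A$ (resp. of $B$) with their product in $A$ (resp. in $B$). $T:A\vee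 B\to B\vee A$ is the natural exchange morphism. A cogroup structure on a graded connected pre-Lie algebra $A$ is a morphism of pre-Lie algebras $\phi:A\to A\vee A$ which is coassociative ($(\phi\vee\mathrm{Id})\phi=(\mathrm{Id}\vee\phi)\phi$) and is the identity on each copy of $A$ (composing $\phi$ with either of the two projections $A\vee A\to A$, which are the identity on one copy and zero on the other, gives $\mathrm{Id}_A$). The cogroup is abelian if $T\phi=\phi$. *)

(* Defs.v *)
From HB Require Import structures.
From mathcomp Require Import all_boot all_order all_algebra.
From mathcomp Require Import boolp.

Set Implicit Arguments.
Unset Strict Implicit.
Unset Printing Implicit Defensive.

Import GRing.Theory.
Local Open Scope ring_scope.
Local Open Scope quotient_scope.

Reserved Notation "x ∘ y" (at level 40, left associativity).
Reserved Notation "x ⊗ y" (at level 40, left associativity).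

HB.mixin Record isPreLie (K : fieldType) (L : Type) of GRing.Lmodule K L := {
  circ : L -> L -> L;
  circ_bilinear : bilinear_for *:%R *:%R circ;
  circ_prelie : forall x y z : L,
    circ (circ x y) z - circ x (circ y z) = circ (circ x z) y - circ x (circ z y)
}.

#[short(type="preLieType")]
HB.structure Definition PreLie (K : fieldType) :=
  {L of GRing.Lmodule K L & isPreLie K L}.

Notation "x ∘ y" := (circ x y) : ring_scope.

HB.instance Definition _ (K : fieldType) (L : preLieType K) :=
  bilinear_isBilinear.Build K L L L *:%R *:%R (@circ K L) (@circ_bilinear K L).

HB.mixin Record isPreLieHom (K : fieldType) (A B : preLieType K) (f : A -> B) := {
  circM : {morph f : x y / x ∘ y}
}.

#[short(type="preLieHom")]
HB.structure Definition PreLieHom (K : fieldType) (A B : preLieType K) :=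
  {f of isPreLieHom K A B f & @GRing.Linear K A B *:%R f}.

(* A grading by the positive integers, given by its homogeneous subspaces:
   every vector is a finite sum of homogeneous ones ([homog_span]), in a unique
   way ([homog_indep]), and the component of degree 0 is zero. *)
HB.mixin Record isPosGraded (K : fieldType) (V : Type) of GRing.Lmodule K V := {
  homog : nat -> V -> Prop;
  homog0 : forall n, homog n 0;
  homogP : forall n a (x y : V), homog n x -> homog n y -> homog n (a *: x + y);
  homog_connected : forall x, homog 0%N x -> x = 0;
  homog_span : forall x, exists N (f : nat -> V),
    (forall n, homog n (f n)) /\ x = \sum_(n < N) f n;
  homog_indep : forall N (f : nat -> V), (forall n, homog n (f n)) ->
    \sum_(n < N) f n = 0 -> forall n, (n < N)%N -> f n = 0
}.

#[short(type="posGradedType")]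
HB.structure Definition PosGraded (K : fieldType) :=
  {V of GRing.Lmodule K V & isPosGraded K V}.

HB.mixin Record isGradedPreLie (K : fieldType) (L : Type)
    of PreLie K L & PosGraded K L := {
  homog_circ : forall m n (x y : L),
    homog m x -> homog n y -> homog (m + n)%N (x ∘ y)
}.

#[short(type="gradedPreLieType")]
HB.structure Definition GradedPreLie (K : fieldType) :=
  {L of PreLie K L & PosGraded K L & isGradedPreLie K L}.

Section HomInstances.
Variables (K : fieldType) (A B C : preLieType K).

Fact idfun_circM : {morph @idfun A : x y / x ∘ y}. Proof. by []. Qed.
HB.instance Definition _ := isPreLieHom.Build K A A idfun idfun_circM.

Fact comp_circM (f : preLieHom B C) (g : preLieHom A B) :
  {morph f \o g : x y / x ∘ y}.
Proof. by move=> x y /=; rewrite !circM. Qed.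
HB.instance Definition _ (f : preLieHom B C) (g : preLieHom A B) :=
  isPreLieHom.Build K A C (f \o g) (comp_circM f g).

Fact null_circM : {morph (\0 : A -> B) : x y / x ∘ y}.
Proof. by move=> x y /=; rewrite linear0l. Qed.
HB.instance Definition _ := isPreLieHom.Build K A B \0 null_circM.

End HomInstances.

(* A list of pairs [(a_i, b_i)] stands for the sum of the [a_i ⊗ b_i]; two such
   formal sums are identified when every bilinear map gives them the same
   value. *)
Section Tensor.
Variables (K : fieldType) (A B : lmodType K).
Implicit Types s t : seq (A * B).

Definition tens_eval (C : lmodType K) (f : A -> B -> C) s :=
  \sum_(p <- s) f p.1 p.2.

Definition tens_eq s t := `[<forall (C : lmodType K) (f : {bilinear A -> B -> C}),
  tens_eval f s = tens_eval f t>].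

Fact tens_eq_refl : reflexive tens_eq. Proof. by move=> s; apply/asboolP. Qed.
Fact tens_eq_sym : symmetric tens_eq.
Proof. by move=> s t; apply/asboolP/asboolP => h C f; rewrite h. Qed.
Fact tens_eq_trans : transitive tens_eq.
Proof.
by move=> t s u /asboolP h1 /asboolP h2; apply/asboolP => C f; rewrite h1 h2.
Qed.

Canonical tens_equiv := EquivRel tens_eq tens_eq_refl tens_eq_sym tens_eq_trans.

Definition tensor := {eq_quot tens_equiv}.
HB.instance Definition _ := Choice.on tensor.
HB.instance Definition _ := EqQuotient.on tensor.

Lemma tensorP s t : \pi_tensor s = \pi_tensor t <->
  forall (C : lmodType K) (f : {bilinear A -> B -> C}),
    tens_eval f s = tens_eval f t.
Proof.
split=> [/eqquotP/asboolP // | h].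
by apply/eqquotP/asboolP.
Qed.

Lemma tens_eval_repr (C : lmodType K) (f : {bilinear A -> B -> C}) s :
  tens_eval f (repr (\pi_tensor s)) = tens_eval f s.
Proof. by move: C f; apply/tensorP; rewrite reprK. Qed.

Let scale (c : K) s := [seq (c *: p.1, p.2) | p <- s].

Let evalD (C : lmodType K) (f : A -> B -> C) s t :
  tens_eval f (s ++ t) = tens_eval f s + tens_eval f t.
Proof. exact: big_cat. Qed.

Let evalZ (C : lmodType K) (f : {bilinear A -> B -> C}) c s :
  tens_eval f (scale c s) = c *: tens_eval f s.
Proof.
rewrite /tens_eval big_map scaler_sumr; apply: eq_bigr => p _ /=.
by rewrite linearZl_LR.
Qed.

Let eval0 (C : lmodType K) (f : A -> B -> C) : tens_eval f [::] = 0.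
Proof. exact: big_nil. Qed.

Definition tens_zero : tensor := \pi_tensor [::].
Definition tens_add (x y : tensor) : tensor := \pi_tensor (repr x ++ repr y).
Definition tens_scale c (x : tensor) : tensor := \pi_tensor (scale c (repr x)).
Definition tens_opp (x : tensor) : tensor := tens_scale (-1) x.

Let evalE := (tens_eval_repr, evalD, evalZ, eval0).

Fact tens_addA : associative tens_add.
Proof. by move=> x y z; apply/tensorP => C f; rewrite !evalE addrA. Qed.
Fact tens_addC : commutative tens_add.
Proof. by move=> x y; apply/tensorP => C f; rewrite !evalE addrC. Qed.
Fact tens_add0 : left_id tens_zero tens_add.
Proof.
by move=> x; rewrite -[RHS]reprK; apply/tensorP => C f; rewrite !evalE add0r.
Qed.
Fact tens_addN : left_inverse tens_zero tens_opp tens_add.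
Proof.
by move=> x; apply/tensorP => C f; rewrite !evalE scaleN1r addNr.
Qed.

HB.instance Definition _ :=
  GRing.isZmodule.Build tensor tens_addA tens_addC tens_add0 tens_addN.

Fact tens_scaleA a b x : tens_scale a (tens_scale b x) = tens_scale (a * b) x.
Proof. by apply/tensorP => C f; rewrite !evalE scalerA. Qed.
Fact tens_scale1 : left_id 1 tens_scale.
Proof.
by move=> x; rewrite -[RHS]reprK; apply/tensorP => C f; rewrite !evalE scale1r.
Qed.
Fact tens_scaleDr : right_distributive tens_scale +%R.
Proof. by move=> a x y; apply/tensorP => C f; rewrite !evalE scalerDr. Qed.
Fact tens_scaleDl x : {morph tens_scale^~ x : a b / a + b}.
Proof. by move=> a b; apply/tensorP => C f; rewrite !evalE scalerDl. Qed.

HB.instance Definition _ := GRing.Zmodule_isLmodule.Build K tensor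
  tens_scaleA tens_scale1 tens_scaleDr tens_scaleDl.

Definition tens (a : A) (b : B) : tensor := \pi_tensor [:: (a, b)].

Fact tens_bilinear : bilinear_for *:%R *:%R tens.
Proof.
split=> [b | a] c x y; apply/tensorP => C f;
  rewrite !evalE /tens_eval !big_seq1 /=.
  by rewrite linearDl linearZl_LR.
by rewrite linearDr linearZr_LR.
Qed.
HB.instance Definition _ :=
  bilinear_isBilinear.Build K A B tensor *:%R *:%R tens tens_bilinear.

Definition tlift (C : lmodType K) (f : {bilinear A -> B -> C}) (x : tensor) : C :=
  tens_eval f (repr x).

Section Lift.
Variables (C : lmodType K) (f : {bilinear A -> B -> C}).

Fact tlift_linear : linear (tlift f).
Proof. by move=> c x y; rewrite /tlift !evalE. Qed.
HB.instance Definition _ :=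
  GRing.isLinear.Build K tensor C *:%R (tlift f) tlift_linear.

Lemma tlift_tens a b : tlift f (tens a b) = f a b.
Proof. by rewrite /tlift tens_eval_repr /tens_eval big_seq1. Qed.

End Lift.

Lemma tensor_sum (x : tensor) : exists s, x = \sum_(p <- s) tens p.1 p.2.
Proof.
exists (repr x); rewrite -[LHS]reprK; elim: (repr x) => [|p s IH].
  by rewrite big_nil.
rewrite big_cons -IH; apply/tensorP => C f.
by rewrite !evalE /tens_eval big_cons big_seq1.
Qed.

Lemma tensor_ind (P : tensor -> Prop) : P 0 ->
  (forall a b x, P x -> P (tens a b + x)) -> forall x, P x.
Proof.
move=> P0 PD x; have [s ->] := tensor_sum x; elim: s => [|p s IH].
  by rewrite big_nil.
by rewrite big_cons; apply: PD.
Qed.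

Lemma tensor_ext (C : lmodType K) (f g : {linear tensor -> C}) :
  (forall a b, f (tens a b) = g (tens a b)) -> f =1 g.
Proof.
by move=> h; elim/tensor_ind => [|a b x IH]; rewrite ?linear0 // !linearD h IH.
Qed.

End Tensor.

Notation "x ⊗ y" := (tens x y) : ring_scope.

Section TensorMap.
Variables (K : fieldType) (A B A' B' : lmodType K).
Variables (f : {linear A -> A'}) (g : {linear B -> B'}).

Definition tmap_fun (a : A) (b : B) : tensor A' B' := f a ⊗ g b.
Fact tmap_bilinear : bilinear_for *:%R *:%R tmap_fun.
Proof.
split=> [b | a] c x y; rewrite /tmap_fun linearP /=.
  by rewrite linearDl linearZl_LR.
by rewrite linearDr linearZr_LR.
Qed.
HB.instance Definition _ :=
  bilinear_isBilinear.Build K A B _ *:%R *:%R tmap_fun tmap_bilinear.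

Definition tmap : tensor A B -> tensor A' B' := tlift tmap_fun.
HB.instance Definition _ := GRing.Linear.on tmap.

Lemma tmap_tens a b : tmap (a ⊗ b) = f a ⊗ g b.
Proof. exact: tlift_tens. Qed.

End TensorMap.

Section Tau23.
Variables (K : fieldType) (A B C : lmodType K).

Definition tau23_fun3 (c : C) (a : A) (b : B) : tensor (tensor A C) B :=
  (a ⊗ c) ⊗ b.
Fact tau23_bilinear3 c : bilinear_for *:%R *:%R (tau23_fun3 c).
Proof.
split=> [b | a] k x y; rewrite /tau23_fun3.
  by rewrite linearDl linearZl_LR linearDl linearZl_LR.
by rewrite linearDr linearZr_LR.
Qed.
HB.instance Definition _ c :=
  bilinear_isBilinear.Build K A B _ *:%R *:%R (tau23_fun3 c) (tau23_bilinear3 c).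

Definition tau23_fun2 (t : tensor A B) (c : C) : tensor (tensor A C) B :=
  tlift (tau23_fun3 c) t.
Fact tau23_bilinear2 : bilinear_for *:%R *:%R tau23_fun2.
Proof.
split=> [c | t] k x y; first exact: linearP.
rewrite /tau23_fun2; elim/tensor_ind: t => [|a b t IH].
  by rewrite !linear0 /= scaler0 addr0.
have e : tau23_fun3 (k *: x + y) a b = k *: tau23_fun3 x a b + tau23_fun3 y a b.
  by rewrite /tau23_fun3 linearDr linearZr_LR linearDl linearZl_LR.
rewrite !(linearD _ (a ⊗ b)) /= IH !tlift_tens /= e.
by rewrite scalerDr addrACA.
Qed.
HB.instance Definition _ :=
  bilinear_isBilinear.Build K (tensor A B) C _ *:%R *:%R tau23_fun2 tau23_bilinear2.

Definition tau23 : tensor (tensor A B) C -> tensor (tensor A C) B :=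
  tlift tau23_fun2.
HB.instance Definition _ := GRing.Linear.on tau23.

Lemma tau23_tens a b c : tau23 ((a ⊗ b) ⊗ c) = (a ⊗ c) ⊗ b.
Proof. by rewrite /tau23 tlift_tens /= /tau23_fun2 tlift_tens. Qed.

End Tau23.

Arguments tau23 {K A B C} _.

(* The right action of [y] on [tensor L L]:
   (x1 ⊗ x2) ∘ y = (x1 ∘ y) ⊗ x2 + x1 ⊗ (x2 ∘ y). *)
Section TensorAction.
Variables (K : fieldType) (L : preLieType K) (y : L).

Definition tact_fun (x1 x2 : L) : tensor L L :=
  (x1 ∘ y) ⊗ x2 + x1 ⊗ (x2 ∘ y).
Fact tact_bilinear : bilinear_for *:%R *:%R tact_fun.
Proof.
split=> [x2 | x1] k u v; rewrite /tact_fun.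
  by rewrite !(linearDl, linearZl_LR) /= scalerDr addrACA.
by rewrite !(linearDr, linearZr_LR, linearDl, linearZl_LR) /= scalerDr addrACA.
Qed.
HB.instance Definition _ :=
  bilinear_isBilinear.Build K L L _ *:%R *:%R tact_fun tact_bilinear.

Definition tact : tensor L L -> tensor L L := tlift tact_fun.
HB.instance Definition _ := GRing.Linear.on tact.

Lemma tact_tens x1 x2 : tact (x1 ⊗ x2) = (x1 ∘ y) ⊗ x2 + x1 ⊗ (x2 ∘ y).
Proof. exact: tlift_tens. Qed.

End TensorAction.

(* The degree n part of A ⊗ B is the sum of the A_i ⊗ B_j with i + j = n. *)
Inductive tens_homog (K : fieldType) (A B : posGradedType K) :
    nat -> tensor A B -> Prop :=
  | tens_homog0 n : tens_homog n 0
  | tens_homogP n c x y :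
      tens_homog n x -> tens_homog n y -> tens_homog n (c *: x + y)
  | tens_homog_tens i j a b :
      homog i a -> homog j b -> tens_homog (i + j)%N (a ⊗ b).

Inductive plterm (K : fieldType) (V : lmodType K) : Type :=
  | PLgen of V
  | PLzero
  | PLadd of plterm V & plterm V
  | PLscale of K & plterm V
  | PLmul of plterm V & plterm V.

Arguments PLzero {K V}.

HB.instance Definition _ K V := gen_eqMixin (@plterm K V).
HB.instance Definition _ K V := gen_choiceMixin (@plterm K V).

(* The free pre-Lie algebra on the vector space [V]: terms over [V], two terms
   being identified when every linear map from [V] to a pre-Lie algebra gives
   them the same value. *)
Section FreePreLie.
Variables (K : fieldType) (V : lmodType K).
Implicit Types s t u : plterm V.

Fixpoint pl_eval (A : preLieType K) (f : V -> A) t : A :=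
  match t with
  | PLgen v => f v
  | PLzero => 0
  | PLadd t1 t2 => pl_eval f t1 + pl_eval f t2
  | PLscale c t1 => c *: pl_eval f t1
  | PLmul t1 t2 => pl_eval f t1 ∘ pl_eval f t2
  end.

Definition pl_eq s t := `[<forall (A : preLieType K) (f : {linear V -> A}),
  pl_eval f s = pl_eval f t>].

Fact pl_eq_refl : reflexive pl_eq. Proof. by move=> s; apply/asboolP. Qed.
Fact pl_eq_sym : symmetric pl_eq.
Proof. by move=> s t; apply/asboolP/asboolP => h A f; rewrite h. Qed.
Fact pl_eq_trans : transitive pl_eq.
Proof.
by move=> t s u /asboolP h1 /asboolP h2; apply/asboolP => A f; rewrite h1 h2.
Qed.

Canonical pl_equiv := EquivRel pl_eq pl_eq_refl pl_eq_sym pl_eq_trans.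

Definition freePL := {eq_quot pl_equiv}.
HB.instance Definition _ := Choice.on freePL.
HB.instance Definition _ := EqQuotient.on freePL.

Lemma freePLP s t : \pi_freePL s = \pi_freePL t <->
  forall (A : preLieType K) (f : {linear V -> A}), pl_eval f s = pl_eval f t.
Proof.
split=> [/eqquotP/asboolP // | h].
by apply/eqquotP/asboolP.
Qed.

Lemma pl_eval_repr (A : preLieType K) (f : {linear V -> A}) s :
  pl_eval f (repr (\pi_freePL s)) = pl_eval f s.
Proof. by move: A f; apply/freePLP; rewrite reprK. Qed.

Definition freePL_zero : freePL := \pi_freePL PLzero.
Definition freePL_add (x y : freePL) : freePL :=
  \pi_freePL (PLadd (repr x) (repr y)).
Definition freePL_scale c (x : freePL) : freePL :=
  \pi_freePL (PLscale c (repr x)).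
Definition freePL_opp (x : freePL) : freePL := freePL_scale (-1) x.
Definition freePL_mul (x y : freePL) : freePL :=
  \pi_freePL (PLmul (repr x) (repr y)).

Fact freePL_addA : associative freePL_add.
Proof. by move=> x y z; apply/freePLP => A f /=; rewrite !pl_eval_repr /= addrA. Qed.
Fact freePL_addC : commutative freePL_add.
Proof. by move=> x y; apply/freePLP => A f /=; rewrite addrC. Qed.
Fact freePL_add0 : left_id freePL_zero freePL_add.
Proof.
move=> x; rewrite -[RHS]reprK; apply/freePLP => A f /=.
by rewrite !pl_eval_repr /= add0r.
Qed.
Fact freePL_addN : left_inverse freePL_zero freePL_opp freePL_add.
Proof.
by move=> x; apply/freePLP => A f /=; rewrite !pl_eval_repr /= scaleN1r addNr.
Qed.

HB.instance Definition _ := GRing.isZmodule.Build freePL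
  freePL_addA freePL_addC freePL_add0 freePL_addN.

Fact freePL_scaleA a b x :
  freePL_scale a (freePL_scale b x) = freePL_scale (a * b) x.
Proof. by apply/freePLP => A f /=; rewrite !pl_eval_repr /= scalerA. Qed.
Fact freePL_scale1 : left_id 1 freePL_scale.
Proof.
by move=> x; rewrite -[RHS]reprK; apply/freePLP => A f /=; rewrite scale1r.
Qed.
Fact freePL_scaleDr : right_distributive freePL_scale +%R.
Proof.
by move=> a x y; apply/freePLP => A f /=; rewrite !pl_eval_repr /= scalerDr.
Qed.
Fact freePL_scaleDl x : {morph freePL_scale^~ x : a b / a + b}.
Proof.
by move=> a b; apply/freePLP => A f /=; rewrite !pl_eval_repr /= scalerDl.
Qed.

HB.instance Definition _ := GRing.Zmodule_isLmodule.Build K freePL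
  freePL_scaleA freePL_scale1 freePL_scaleDr freePL_scaleDl.

Let evalD (A : preLieType K) (f : {linear V -> A}) (x y : freePL) :
  pl_eval f (repr (x + y)) = pl_eval f (repr x) + pl_eval f (repr y).
Proof. exact: pl_eval_repr. Qed.
Let evalZ (A : preLieType K) (f : {linear V -> A}) c (x : freePL) :
  pl_eval f (repr (c *: x)) = c *: pl_eval f (repr x).
Proof. exact: pl_eval_repr. Qed.
Let evalM (A : preLieType K) (f : {linear V -> A}) x y :
  pl_eval f (repr (freePL_mul x y)) = pl_eval f (repr x) ∘ pl_eval f (repr y).
Proof. exact: pl_eval_repr. Qed.
Let evalE := (evalD, evalZ, evalM).

Fact freePL_mul_bilinear : bilinear_for *:%R *:%R freePL_mul.
Proof.
split=> [y | x] c u v; apply/freePLP => A f /=; rewrite pl_eval_repr /= !evalE.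
  by rewrite linearDl linearZl_LR.
by rewrite linearDr linearZr_LR.
Qed.
Fact freePL_mul_prelie x y z :
  freePL_mul (freePL_mul x y) z - freePL_mul x (freePL_mul y z) =
  freePL_mul (freePL_mul x z) y - freePL_mul x (freePL_mul z y).
Proof.
rewrite -!(scaleN1r (freePL_mul _ _)); apply/freePLP => A f /=.
by rewrite !evalE !scaleN1r circ_prelie.
Qed.

HB.instance Definition _ :=
  isPreLie.Build K freePL freePL_mul_bilinear freePL_mul_prelie.

Definition fgen (v : V) : freePL := \pi_freePL (PLgen v).

Fact fgen_linear : linear fgen.
Proof.
by move=> c x y; apply/freePLP => A f /=; rewrite !pl_eval_repr /= linearP pl_eval_repr.
Qed.
HB.instance Definition _ :=
  GRing.isLinear.Build K V freePL *:%R fgen fgen_linear.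

Definition flift (A : preLieType K) (f : {linear V -> A}) (x : freePL) : A :=
  pl_eval f (repr x).

Section Lift.
Variables (A : preLieType K) (f : {linear V -> A}).

Fact flift_linear : linear (flift f).
Proof. by move=> c x y; rewrite /flift pl_eval_repr /= pl_eval_repr. Qed.
HB.instance Definition _ :=
  GRing.isLinear.Build K freePL A *:%R (flift f) flift_linear.

Fact flift_circM : {morph flift f : x y / x ∘ y}.
Proof. by move=> x y; rewrite /flift pl_eval_repr. Qed.
HB.instance Definition _ :=
  isPreLieHom.Build K freePL A (flift f) flift_circM.

Lemma flift_gen v : flift f (fgen v) = f v.
Proof. by rewrite /flift pl_eval_repr. Qed.

End Lift.

Lemma freePL_ind (P : freePL -> Prop) :
  (forall v, P (fgen v)) ->
  (forall c x y, P x -> P y -> P (c *: x + y)) ->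
  (forall x y, P x -> P y -> P (x ∘ y)) ->
  forall x, P x.
Proof.
move=> Pg Pl Pm x; rewrite -[x]reprK.
have P0 : P 0 by rewrite -(linear0 fgen).
elim: (repr x) => {x} [v | | s IHs t IHt | c t IHt | s IHs t IHt].
- exact: Pg.
- exact: P0.
- have -> : \pi_freePL (PLadd s t) = 1 *: \pi_freePL s + \pi_freePL t.
    by apply/freePLP => A f /=; rewrite !pl_eval_repr /= pl_eval_repr scale1r.
  exact: Pl.
- have -> : \pi_freePL (PLscale c t) = c *: \pi_freePL t + 0.
    by apply/freePLP => A f /=; rewrite !pl_eval_repr /= pl_eval_repr addr0.
  exact: Pl.
- have -> : \pi_freePL (PLmul s t) = \pi_freePL s ∘ \pi_freePL t.
    by apply/freePLP => A f /=; rewrite !pl_eval_repr.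
  exact: Pm.
Qed.

Lemma freePL_ext (A : preLieType K) (f g : preLieHom freePL A) :
  (forall v, f (fgen v) = g (fgen v)) -> f =1 g.
Proof.
move=> h; elim/freePL_ind => [// | c x y hx hy | x y hx hy].
  by rewrite !linearP /= hx hy.
by rewrite !circM hx hy.
Qed.

End FreePreLie.

Section Ideal.
Variables (K : fieldType) (L : preLieType K).

Definition is_ideal (I : L -> Prop) : Prop :=
  [/\ I 0,
      forall c x y, I x -> I y -> I (c *: x + y)
    & forall x y, I x -> I (x ∘ y) /\ I (y ∘ x)].

Definition ideal_gen (R : L -> Prop) (x : L) : Prop :=
  forall I, is_ideal I -> (forall r, R r -> I r) -> I x.

Lemma ideal_gen_is_ideal R : is_ideal (ideal_gen R).
Proof.
split=> [I [] // | c x y hx hy I hI hR | x y hx].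
  by case: (hI) => _ hl _; apply: hl; [apply: hx | apply: hy].
by split=> I hI hR; case: (hI) => _ _ /(_ x y); case; do ?[exact: hx].
Qed.

Lemma ideal_gen_sub (R : L -> Prop) r : R r -> ideal_gen R r.
Proof. by move=> hr I _; apply. Qed.

End Ideal.

Section Quotient.
Variables (K : fieldType) (L : preLieType K) (R : L -> Prop).

Let I := ideal_gen R.
Let I0 : I 0. Proof. by case: (ideal_gen_is_ideal R). Qed.
Let IP c x y : I x -> I y -> I (c *: x + y).
Proof. by case: (ideal_gen_is_ideal R) => _ h _; apply: h. Qed.
Let IMl x y : I x -> I (x ∘ y).
Proof. by case: (ideal_gen_is_ideal R) => _ _ h /(h _ y)[]. Qed.
Let IMr x y : I x -> I (y ∘ x).
Proof. by case: (ideal_gen_is_ideal R) => _ _ h /(h _ y)[]. Qed.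
Let ID x y : I x -> I y -> I (x + y).
Proof. by move=> hx hy; rewrite -(scale1r x); apply: IP. Qed.
Let IZ c x : I x -> I (c *: x).
Proof. by move=> hx; rewrite -(addr0 (c *: x)); apply: IP. Qed.
Let IN x : I x -> I (- x).
Proof. by move=> hx; rewrite -scaleN1r; apply: IZ. Qed.

Definition plquot_eq (x y : L) := `[<ideal_gen R (x - y)>].

Fact plquot_eq_refl : reflexive plquot_eq.
Proof. by move=> x; apply/asboolP; rewrite subrr. Qed.
Fact plquot_eq_sym : symmetric plquot_eq.
Proof.
by move=> x y; apply/asboolP/asboolP => h; rewrite -opprB; apply: IN.
Qed.
Fact plquot_eq_trans : transitive plquot_eq.
Proof.
move=> y x z /asboolP h1 /asboolP h2; apply/asboolP.
by rewrite -(subrK y x) -addrA; apply: ID.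
Qed.

Canonical plquot_equiv :=
  EquivRel plquot_eq plquot_eq_refl plquot_eq_sym plquot_eq_trans.

Definition plquot := {eq_quot plquot_equiv}.
HB.instance Definition _ := Choice.on plquot.
HB.instance Definition _ := EqQuotient.on plquot.

Lemma plquotP x y : \pi_plquot x = \pi_plquot y <-> ideal_gen R (x - y).
Proof. by split=> [/eqquotP/asboolP // | h]; apply/eqquotP/asboolP. Qed.

Let reprI x : I (repr (\pi_plquot x) - x).
Proof. by apply/plquotP; rewrite reprK. Qed.

Definition plquot_zero : plquot := \pi_plquot 0.
Definition plquot_add (x y : plquot) : plquot := \pi_plquot (repr x + repr y).
Definition plquot_scale c (x : plquot) : plquot := \pi_plquot (c *: repr x).
Definition plquot_opp (x : plquot) : plquot := \pi_plquot (- repr x).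
Definition plquot_mul (x y : plquot) : plquot := \pi_plquot (repr x ∘ repr y).

Let piD x y : \pi_plquot (x + y) = plquot_add (\pi_plquot x) (\pi_plquot y).
Proof.
apply: esym; apply/plquotP; rewrite opprD addrACA; exact: ID.
Qed.
Let piZ c x : \pi_plquot (c *: x) = plquot_scale c (\pi_plquot x).
Proof. by apply: esym; apply/plquotP; rewrite -scalerBr; apply: IZ. Qed.
Let piN x : \pi_plquot (- x) = plquot_opp (\pi_plquot x).
Proof. by apply: esym; apply/plquotP; rewrite -opprD; apply: IN. Qed.
Let piM x y : \pi_plquot (x ∘ y) = plquot_mul (\pi_plquot x) (\pi_plquot y).
Proof.
apply: esym; apply/plquotP.
rewrite -(subrK (x ∘ repr (\pi_plquot y)) (_ ∘ repr _)) -addrA.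
by rewrite -linearBl -linearBr; apply: ID; [apply: IMl | apply: IMr].
Qed.

Let quotW (P : plquot -> Prop) : (forall x, P (\pi_plquot x)) -> forall q, P q.
Proof. by move=> h q; rewrite -[q]reprK. Qed.

Fact plquot_addA : associative plquot_add.
Proof.
elim/quotW=> x; elim/quotW=> y; elim/quotW=> z.
by rewrite -!piD addrA.
Qed.
Fact plquot_addC : commutative plquot_add.
Proof. by move=> x y; rewrite /plquot_add addrC. Qed.
Fact plquot_add0 : left_id plquot_zero plquot_add.
Proof. by elim/quotW=> x; rewrite -piD add0r. Qed.
Fact plquot_addN : left_inverse plquot_zero plquot_opp plquot_add.
Proof. by elim/quotW=> x; rewrite -piN -piD addNr. Qed.

HB.instance Definition _ := GRing.isZmodule.Build plquot
  plquot_addA plquot_addC plquot_add0 plquot_addN.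

Fact plquot_scaleA a b x :
  plquot_scale a (plquot_scale b x) = plquot_scale (a * b) x.
Proof. by elim/quotW: x => x; rewrite -!piZ scalerA. Qed.
Fact plquot_scale1 : left_id 1 plquot_scale.
Proof. by elim/quotW=> x; rewrite -piZ scale1r. Qed.
Fact plquot_scaleDr : right_distributive plquot_scale +%R.
Proof.
move=> a; elim/quotW=> x; elim/quotW=> y.
by rewrite -[_ + _]piD -!piZ scalerDr piD.
Qed.
Fact plquot_scaleDl x : {morph plquot_scale^~ x : a b / a + b}.
Proof. by move=> a b; elim/quotW: x => x; rewrite -!piZ scalerDl piD. Qed.

HB.instance Definition _ := GRing.Zmodule_isLmodule.Build K plquot
  plquot_scaleA plquot_scale1 plquot_scaleDr plquot_scaleDl.

Let piD' x y : \pi_plquot (x + y) = \pi_plquot x + \pi_plquot y.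
Proof. exact: piD. Qed.
Let piZ' c x : \pi_plquot (c *: x) = c *: \pi_plquot x.
Proof. exact: piZ. Qed.
Let piN' x : \pi_plquot (- x) = - \pi_plquot x.
Proof. exact: piN. Qed.

Fact plquot_mul_bilinear : bilinear_for *:%R *:%R plquot_mul.
Proof.
split; elim/quotW=> y c; elim/quotW=> u; elim/quotW=> v.
  by rewrite -piZ' -piD' -!piM /= -piZ' -piD' linearDl linearZl_LR.
by rewrite -piZ' -piD' -!piM /= -piZ' -piD' linearDr linearZr_LR.
Qed.
Fact plquot_mul_prelie x y z :
  plquot_mul (plquot_mul x y) z - plquot_mul x (plquot_mul y z) =
  plquot_mul (plquot_mul x z) y - plquot_mul x (plquot_mul z y).
Proof.
elim/quotW: x => x; elim/quotW: y => y; elim/quotW: z => z.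
by rewrite -!piM -!piN' -!piD' circ_prelie.
Qed.

HB.instance Definition _ :=
  isPreLie.Build K plquot plquot_mul_bilinear plquot_mul_prelie.

Definition plproj (x : L) : plquot := \pi_plquot x.

Fact plproj_linear : linear plproj.
Proof. by move=> c x y; rewrite /plproj piD piZ. Qed.
HB.instance Definition _ :=
  GRing.isLinear.Build K L plquot *:%R plproj plproj_linear.
Fact plproj_circM : {morph plproj : x y / x ∘ y}.
Proof. exact: piM. Qed.
HB.instance Definition _ := isPreLieHom.Build K L plquot plproj plproj_circM.

Lemma plproj_eq0 x : plproj x = 0 <-> ideal_gen R x.
Proof. by rewrite -(linear0 plproj) -[x in ideal_gen _ x]subr0; apply: plquotP. Qed.

Lemma plproj_surj q : exists x, q = plproj x.
Proof. by exists (repr q); rewrite /plproj reprK. Qed.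

Section Lift.
Variables (A : preLieType K) (f : preLieHom L A) (fR : forall r, R r -> f r = 0).

Definition qlift of (forall r, R r -> f r = 0) := fun q : plquot => f (repr q).

Lemma qlift_proj x : qlift fR (plproj x) = f x.
Proof.
suff h : f (repr (\pi_plquot x) - x) = 0.
  by apply/eqP; rewrite -subr_eq0 -linearB; apply/eqP.
apply: (@reprI x (fun z => f z = 0)) => //; split=> [|c u v hu hv|u v hu].
- exact: linear0.
- by rewrite linearP /= hu hv scaler0 addr0.
- by rewrite !circM hu linear0l linear0r.
Qed.

Fact qlift_linear : linear (qlift fR).
Proof.
move=> c p q; have [x ->] := plproj_surj p; have [y ->] := plproj_surj q.
by rewrite -plproj_linear !qlift_proj linearP.
Qed.
HB.instance Definition _ :=
  GRing.isLinear.Build K plquot A *:%R (qlift fR) qlift_linear.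
Fact qlift_circM : {morph qlift fR : x y / x ∘ y}.
Proof.
move=> p q; have [x ->] := plproj_surj p; have [y ->] := plproj_surj q.
by rewrite -plproj_circM !qlift_proj circM.
Qed.
HB.instance Definition _ :=
  isPreLieHom.Build K plquot A (qlift fR) qlift_circM.

End Lift.
End Quotient.

(* The coproduct A ∨ B: the quotient of the free pre-Lie algebra on A ⊕ B by
   the ideal identifying the free product of two elements of A (resp. of B)
   with their product in A (resp. in B). *)
Section Coproduct.
Variables (K : fieldType) (A B : preLieType K).

Definition coprod_rel (r : freePL (A * B)%type) : Prop :=
  (exists a a' : A, r = fgen (a, 0) ∘ fgen (a', 0) - fgen (a ∘ a', 0))
  \/ (exists b b' : B, r = fgen (0, b) ∘ fgen (0, b') - fgen (0, b ∘ b')).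

Definition coprod := plquot coprod_rel.
HB.instance Definition _ := PreLie.on coprod.

Definition inl_pl (a : A) : coprod := plproj coprod_rel (fgen (a, 0)).
Definition inr_pl (b : B) : coprod := plproj coprod_rel (fgen (0, b)).

Fact inl_pl_linear : linear inl_pl.
Proof.
move=> c x y; rewrite /inl_pl.
have -> : (c *: x + y, 0) = c *: (x, 0) + (y, 0) :> A * B.
  by congr (_, _); rewrite /= scaler0 addr0.
by rewrite !linearP.
Qed.
HB.instance Definition _ :=
  GRing.isLinear.Build K A coprod *:%R inl_pl inl_pl_linear.
Fact inl_pl_circM : {morph inl_pl : x y / x ∘ y}.
Proof.
move=> x y; apply/esym/eqP; rewrite -subr_eq0 /inl_pl -circM -linearB.
by apply/eqP; apply/plproj_eq0; apply: ideal_gen_sub; left; exists x, y.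
Qed.
HB.instance Definition _ := isPreLieHom.Build K A coprod inl_pl inl_pl_circM.

Fact inr_pl_linear : linear inr_pl.
Proof.
move=> c x y; rewrite /inr_pl.
have -> : (0, c *: x + y) = c *: (0, x) + (0, y) :> A * B.
  by congr (_, _); rewrite /= scaler0 addr0.
by rewrite !linearP.
Qed.
HB.instance Definition _ :=
  GRing.isLinear.Build K B coprod *:%R inr_pl inr_pl_linear.
Fact inr_pl_circM : {morph inr_pl : x y / x ∘ y}.
Proof.
move=> x y; apply/esym/eqP; rewrite -subr_eq0 /inr_pl -circM -linearB.
by apply/eqP; apply/plproj_eq0; apply: ideal_gen_sub; right; exists x, y.
Qed.
HB.instance Definition _ := isPreLieHom.Build K B coprod inr_pl inr_pl_circM.

Lemma coprod_ext (C : preLieType K) (f g : preLieHom coprod C) :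
  (forall a, f (inl_pl a) = g (inl_pl a)) ->
  (forall b, f (inr_pl b) = g (inr_pl b)) -> f =1 g.
Proof.
move=> hl hr q; have [x ->] := plproj_surj q.
apply: (freePL_ext (f := f \o plproj coprod_rel) (g := g \o plproj coprod_rel)).
move=> [a b] /=.
have -> : (a, b) = (a, 0) + (0, b) :> A * B by congr (_, _); rewrite /= ?addr0 ?add0r.
by rewrite !linearD /= [f _]hl [f _]hr.
Qed.

Section Copair.
Variables (C : preLieType K) (f : preLieHom A C) (g : preLieHom B C).

Definition copair_fun (p : A * B) : C := f p.1 + g p.2.
Fact copair_fun_linear : linear copair_fun.
Proof. by move=> c x y; rewrite /copair_fun !linearP scalerDr addrACA. Qed.
HB.instance Definition _ :=
  GRing.isLinear.Build K (A * B)%type C *:%R copair_fun copair_fun_linear.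

Fact copair_rel r : coprod_rel r -> flift copair_fun r = 0.
Proof.
case=> -[x [y ->]]; rewrite linearB /= circM /= !flift_gen /= /copair_fun /=.
  by rewrite !linear0 !addr0 circM subrr.
by rewrite !linear0 !add0r circM subrr.
Qed.

Definition copair : coprod -> C := qlift copair_rel.
HB.instance Definition _ := PreLieHom.on copair.

Lemma copair_inl a : copair (inl_pl a) = f a.
Proof.
by rewrite /copair qlift_proj /= flift_gen /= /copair_fun linear0 addr0.
Qed.
Lemma copair_inr b : copair (inr_pl b) = g b.
Proof.
by rewrite /copair qlift_proj /= flift_gen /= /copair_fun linear0 add0r.
Qed.

End Copair.
End Coproduct.

Arguments inl_pl {K A B} a.
Arguments inr_pl {K A B} b.

Section CoproductMaps.
Variables (K : fieldType) (A B C A' B' : preLieType K).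
Variables (f : preLieHom A A') (g : preLieHom B B').

Definition coprod_map : coprod A B -> coprod A' B' :=
  copair (inl_pl \o f) (inr_pl \o g).
HB.instance Definition _ := PreLieHom.on coprod_map.

(* The canonical isomorphism (A ∨ B) ∨ C -> A ∨ (B ∨ C). *)
Definition coprod_assoc : coprod (coprod A B) C -> coprod A (coprod B C) :=
  copair (copair inl_pl (inr_pl \o inl_pl)) (inr_pl \o inr_pl).
HB.instance Definition _ := PreLieHom.on coprod_assoc.

Definition coprod_swap : coprod A B -> coprod B A := copair inr_pl inl_pl.
HB.instance Definition _ := PreLieHom.on coprod_swap.

Definition coprod_proj1 : coprod A B -> A := copair idfun \0.
HB.instance Definition _ := PreLieHom.on coprod_proj1.

Definition coprod_proj2 : coprod A B -> B := copair \0 idfun.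
HB.instance Definition _ := PreLieHom.on coprod_proj2.

End CoproductMaps.

Arguments coprod_assoc {K A B C} _.
Arguments coprod_swap {K A B} _.
Arguments coprod_proj1 {K A B} _.
Arguments coprod_proj2 {K A B} _.

(* The smallest family of subspaces of [A] that contains the elements of
   degree n prescribed by [G] and is compatible with the product. *)
Inductive gen_homog (K : fieldType) (A : preLieType K) (G : nat -> A -> Prop) :
    nat -> A -> Prop :=
  | gen_homog0 n : gen_homog G n 0
  | gen_homogP n c x y :
      gen_homog G n x -> gen_homog G n y -> gen_homog G n (c *: x + y)
  | gen_homog_gen n x : G n x -> gen_homog G n x
  | gen_homog_circ m n x y :
      gen_homog G m x -> gen_homog G n y -> gen_homog G (m + n)%N (x ∘ y).

Definition free_homog (K : fieldType) (V : posGradedType K) :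
    nat -> freePL V -> Prop :=
  gen_homog (fun n x => exists2 v : V, homog n v & x = fgen v).

Definition coprod_homog (K : fieldType) (A B : gradedPreLieType K) :
    nat -> coprod A B -> Prop :=
  gen_homog (fun n x => (exists2 a : A, homog n a & x = inl_pl a)
                     \/ (exists2 b : B, homog n b & x = inr_pl b)).

Definition nap_coproduct (K : fieldType) (C : lmodType K)
    (Delta : {linear C -> tensor C C}) : Prop :=
  forall x : C,
    tmap Delta idfun (Delta x) - tau23 (tmap Delta idfun (Delta x)) = 0.

Definition compatible_nap (K : fieldType) (L : gradedPreLieType K) : Prop :=
  exists Delta : {linear L -> tensor L L},
    [/\ forall n x, homog n x -> tens_homog n (Delta x),
        nap_coproduct Delta
      & forall x y : L, Delta (x ∘ y) = x ⊗ y + tact y (Delta x)].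

Definition graded_free (K : fieldType) (L : gradedPreLieType K) : Prop :=
  exists (V : posGradedType K) (f : preLieHom (freePL V) L),
    bijective f /\ forall n x, free_homog n x <-> homog n (f x).

Definition is_cogroup (K : fieldType) (A : gradedPreLieType K)
    (phi : preLieHom A (coprod A A)) : Prop :=
  [/\ forall n x, homog n x -> coprod_homog n (phi x),
      forall x, coprod_assoc (coprod_map phi idfun (phi x)) =
                coprod_map idfun phi (phi x),
      forall x, coprod_proj1 (phi x) = x
    & forall x, coprod_proj2 (phi x) = x].

Definition abelian_cogroup (K : fieldType) (L : gradedPreLieType K) : Prop :=
  exists phi : preLieHom L (coprod L L),
    is_cogroup phi /\ forall x, coprod_swap (phi x) = phi x.

(* Main.v *)
(** A bijective morphism from a free pre-Lie algebra transports to L the abelian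
    cogroup structure v |-> v + v' of the free one.

    From a cogroup map phi one gets Delta: the vector space (A x B) + A (x) B is
    a pre-Lie algebra where (a, b) o (a', b') has fibre a (x) b' and A x B acts
    on A (x) B by derivations, so A \/ B maps to it, and Delta x is the fibre of
    the image of phi x.  A further extension by A (x) B (x) C receives
    A \/ (B \/ C) and turns coassociativity of phi into the symmetry of
    (Delta (x) Id) Delta under tau23.

    Given Delta, the operator E = mul Delta is diagonalisable with natural
    eigenvalues along the filtration by iterated coproducts: if Delta x is a sum
    of a (x) b with a in step n, then (E - n) x is in step n.  In
    characteristic 0 this gives L = ker E + im E, a direct sum, with
    ker E = ker Delta and L o L inside im E.  The inclusion of V = ker E extends
    to a morphism freePL V -> L, which is onto by induction on the degree; a left
    inverse is built on words of length n by induction on n, reading x = e + E q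
    as e + mul (Delta q). *)

From HB Require Import structures.
Require Import Defs.
From mathcomp Require Import all_boot all_order all_algebra.
From mathcomp Require Import boolp.

Set Implicit Arguments.
Unset Strict Implicit.
Unset Printing Implicit Defensive.

Import GRing.Theory.
Local Open Scope ring_scope.

(** * Linear and inductive tools on tensors and coproducts *)

Section Prelim.
Variable K : fieldType.

Section BilOf.
Variables (A B C : lmodType K) (f : A -> B -> C).
Hypothesis f_bil : bilinear_for *:%R *:%R f.
(** The proof of bilinearity is an argument so that structure inference can turn an anonymous
    function into a bilinear map. *)
Definition bil_of of bilinear_for *:%R *:%R f := f.
HB.instance Definition _ :=
  bilinear_isBilinear.Build K A B C *:%R *:%R (bil_of f_bil) f_bil.
End BilOf.

Section Tspan.
Variables A B : lmodType K.

(** An inductive span lets a linear map be followed by induction, without choosing a finite sum.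
    Filtration steps, word lengths and degrees of tensors are all handled in this form. *)
Inductive tspan (P : A -> B -> Prop) : tensor A B -> Prop :=
  | tspan0 : tspan P 0
  | tspanP c x y : tspan P x -> tspan P y -> tspan P (c *: x + y)
  | tspan_tens a b : P a b -> tspan P (a ⊗ b).

Lemma tspanD P x y : tspan P x -> tspan P y -> tspan P (x + y).
Proof. by move=> hx hy; rewrite -[x]scale1r; apply: tspanP. Qed.

Lemma tspan_lin (C : lmodType K) (f : {linear tensor A B -> C}) P (Q : C -> Prop) :
  Q 0 -> (forall c x y, Q x -> Q y -> Q (c *: x + y)) ->
  (forall a b, P a b -> Q (f (a ⊗ b))) ->
  forall x, tspan P x -> Q (f x).
Proof.
move=> Q0 QP hf x; elim=> {x} [|c x y _ hx _ hy|a b /hf //].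
  by rewrite linear0.
by rewrite linearP; apply: QP.
Qed.

Lemma tspan_sub (P Q : A -> B -> Prop) x :
  (forall a b, P a b -> Q a b) -> tspan P x -> tspan Q x.
Proof.
move=> h; elim=> {x} [|c x y _ hx _ hy|a b /h hab].
- exact: tspan0.
- exact: tspanP.
- exact: tspan_tens.
Qed.

End Tspan.

Lemma tens_homogE (A B : posGradedType K) n (x : tensor A B) :
  tens_homog n x <->
  tspan (fun a b => exists i j, [/\ homog i a, homog j b & (i + j)%N = n]) x.
Proof.
split; first elim=> {n x}.
- by move=> n; apply: tspan0.
- by move=> n c x y _ hx _ hy; apply: tspanP.
- by move=> i j a b ha hb; apply: tspan_tens; exists i, j.
elim=> {x} [|c x y _ hx _ hy|a b [i [j [ha hb <-]]]].
- exact: tens_homog0.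
- exact: tens_homogP.
- exact: tens_homog_tens.
Qed.

Lemma tensPl (A B : lmodType K) c (x y : A) (z : B) :
  (c *: x + y) ⊗ z = c *: (x ⊗ z) + y ⊗ z.
Proof. by rewrite linearDl linearZl_LR. Qed.
Lemma tensPr (A B : lmodType K) c (x y : B) (z : A) :
  z ⊗ (c *: x + y) = c *: (z ⊗ x) + z ⊗ y.
Proof. by rewrite linearDr linearZr_LR. Qed.

Lemma tmapD (A B A' B' : lmodType K) (f : {linear A -> A'}) (g : {linear B -> B'}) s t :
  tmap f g (s + t) = tmap f g s + tmap f g t.
Proof. exact: linearD. Qed.
Lemma tmap0 (A B A' B' : lmodType K) (f : {linear A -> A'}) (g : {linear B -> B'}) :
  tmap f g 0 = 0.
Proof. exact: linear0. Qed.
Lemma tau23D (A B C : lmodType K) (s t : tensor (tensor A B) C) :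
  tau23 (s + t) = tau23 s + tau23 t.
Proof. exact: linearD. Qed.
Lemma tau230 (A B C : lmodType K) : tau23 (0 : tensor (tensor A B) C) = 0.
Proof. exact: linear0. Qed.
Lemma tensDl (A B : lmodType K) (x y : A) (z : B) : (x + y) ⊗ z = x ⊗ z + y ⊗ z.
Proof. exact: linearDl. Qed.
Lemma tens0l (A B : lmodType K) (z : B) : (0 : A) ⊗ z = 0.
Proof. exact: linear0l. Qed.
Lemma tens0r (A B : lmodType K) (z : A) : z ⊗ (0 : B) = 0.
Proof. exact: linear0r. Qed.

Section Mult.
Variable L : preLieType K.

Lemma circPl c (x y z : L) : (c *: x + y) ∘ z = c *: (x ∘ z) + y ∘ z.
Proof. by rewrite linearDl linearZl_LR. Qed.
Lemma circPr c (x y z : L) : z ∘ (c *: x + y) = c *: (z ∘ x) + z ∘ y.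
Proof. by rewrite linearDr linearZr_LR. Qed.

Definition rmul (y x : L) : L := x ∘ y.
Fact rmul_linear y : linear (rmul y).
Proof. by move=> c u v; apply: circPl. Qed.
HB.instance Definition _ y := GRing.isLinear.Build K L L *:%R (rmul y) (rmul_linear y).

Definition tmul : tensor L L -> L := tlift (@circ K L).
HB.instance Definition _ := GRing.Linear.on tmul.
Lemma tmul_tens x y : tmul (x ⊗ y) = x ∘ y.
Proof. exact: tlift_tens. Qed.

Lemma tmap_rmull (B B' : lmodType K) (g : {linear B -> B'}) y a b :
  tmap (rmul y) g (a ⊗ b) = (a ∘ y) ⊗ g b.
Proof. exact: tmap_tens. Qed.
Lemma tmap_rmulr (B B' : lmodType K) (g : {linear B -> B'}) y a b :
  tmap g (rmul y) (b ⊗ a) = g b ⊗ (a ∘ y).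
Proof. exact: tmap_tens. Qed.

Lemma tactE y t : tact y t = tmap (rmul y) idfun t + tmap idfun (rmul y) t.
Proof.
elim/tensor_ind: t => [|a b t IH]; first by rewrite !linear0 addr0.
by rewrite !linearD /= IH tact_tens tmap_rmull tmap_rmulr addrACA.
Qed.

Lemma tmap_rmulr_bilinear (B : lmodType K) :
  bilinear_for *:%R *:%R (fun (t : tensor B L) y => tmap idfun (rmul y) t).
Proof.
split=> [y|t] c u v /=; first exact: linearP.
elim/tensor_ind: t => [|a b t IH]; first by rewrite !linear0 ?scaler0 addr0.
have e : tmap idfun (rmul (c *: u + v)) (a ⊗ b) =
    c *: tmap idfun (rmul u) (a ⊗ b) + tmap idfun (rmul v) (a ⊗ b).
  by rewrite !tmap_rmulr circPr tensPr.
by rewrite !(linearD _ (a ⊗ b)) /= IH e scalerDr addrACA.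
Qed.

End Mult.

Lemma tmap_id (A B : lmodType K) (t : tensor A B) :
  tmap idfun idfun t = t.
Proof.
by elim/tensor_ind: t => [|a b t IH]; rewrite ?linear0 ?linearD //= IH tmap_tens.
Qed.

Lemma tmap_comp (A B A1 B1 A2 B2 : lmodType K)
    (f : {linear A -> A1}) (g : {linear B -> B1})
    (f' : {linear A1 -> A2}) (g' : {linear B1 -> B2}) t :
  tmap f' g' (tmap f g t) = tmap (f' \o f) (g' \o g) t.
Proof.
by elim/tensor_ind: t => [|a b t IH]; rewrite ?linear0 ?linearD //= IH !tmap_tens.
Qed.

Lemma tmap_ext (A B A' B' : lmodType K)
    (f f' : {linear A -> A'}) (g g' : {linear B -> B'}) t :
  f =1 f' -> g =1 g' -> tmap f g t = tmap f' g' t.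
Proof.
move=> ef eg; elim/tensor_ind: t => [|a b t IH]; first by rewrite !linear0.
by rewrite !linearD /= IH !tmap_tens ef eg.
Qed.

(** The two copies generate the coproduct: a vector (a, b) splits as (a, 0) + (0, b), and induction
    on the free algebra passes to the quotient. *)
Lemma coprod_ind (A B : preLieType K) (P : coprod A B -> Prop) :
  (forall a, P (inl_pl a)) -> (forall b, P (inr_pl b)) ->
  (forall c x y, P x -> P y -> P (c *: x + y)) ->
  (forall x y, P x -> P y -> P (x ∘ y)) -> forall q, P q.
Proof.
move=> Pl Pr Plin Pm q; have [x ->] := plproj_surj q.
elim/freePL_ind: x => [[a b]|c x y hx hy|x y hx hy].
- have -> : (a, b) = 1 *: (a, 0) + (0, b) :> A * B.
    by rewrite scale1r; congr (_, _); rewrite /= ?addr0 ?add0r.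
  by rewrite !linearP /=; apply: Plin; [apply: Pl|apply: Pr].
- by rewrite linearP; apply: Plin.
- by rewrite circM; apply: Pm.
Qed.

End Prelim.

(** * Extensions of pre-Lie algebras *)

Section ProdPreLie.
Variables (K : fieldType) (A B : preLieType K).

Definition prod_circ (p q : A * B) : A * B := (p.1 ∘ q.1, p.2 ∘ q.2).
Fact prod_circ_bilinear : bilinear_for *:%R *:%R prod_circ.
Proof.
by split=> [y|x] c u v; congr (_, _); rewrite /= ?circPl ?circPr.
Qed.
Fact prod_circ_prelie x y z :
  prod_circ (prod_circ x y) z - prod_circ x (prod_circ y z) =
  prod_circ (prod_circ x z) y - prod_circ x (prod_circ z y).
Proof. by congr (_, _); rewrite /= circ_prelie. Qed.
HB.instance Definition _ :=
  isPreLie.Build K (A * B)%type prod_circ_bilinear prod_circ_prelie.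

End ProdPreLie.

Section Extension.
Variables (K : fieldType) (P : preLieType K) (W : lmodType K).
Variables (alpha : {bilinear P -> P -> W}) (rho : {bilinear W -> P -> W}).

(** A cocycle condition: the fibre part of the pre-Lie identity on elements of the base. *)
Definition ext_alpha_axiom := forall x y z : P,
  alpha (x ∘ y) z + rho (alpha x y) z - alpha x (y ∘ z) =
  alpha (x ∘ z) y + rho (alpha x z) y - alpha x (z ∘ y).
(** Equivalently, W is a right module over the Lie algebra P with bracket y ∘ z - z ∘ y. *)
Definition ext_rho_axiom := forall (s : W) (y z : P),
  rho (rho s y) z - rho s (y ∘ z) = rho (rho s z) y - rho s (z ∘ y).

Variables (alphaP : ext_alpha_axiom) (rhoP : ext_rho_axiom).

Definition extension of ext_alpha_axiom & ext_rho_axiom := (P * W)%type.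
Local Notation E := (extension alphaP rhoP).
HB.instance Definition _ := GRing.Lmodule.copy E (P * W)%type.

(** W becomes an ideal of square zero killed by left multiplications; only the right action of P on
    it remains. *)
Definition ext_circ (p q : E) : E :=
  (p.1 ∘ q.1, alpha p.1 q.1 + rho p.2 q.1).
Fact ext_circ_bilinear : bilinear_for *:%R *:%R ext_circ.
Proof.
split=> [y|x] c u v; congr (_, _); rewrite /= ?circPl ?circPr //.
  by rewrite !(linearDl, linearZl_LR) /= scalerDr addrACA.
by rewrite !(linearDr, linearZr_LR) /= scalerDr addrACA.
Qed.
Fact ext_circ_prelie x y z :
  ext_circ (ext_circ x y) z - ext_circ x (ext_circ y z) =
  ext_circ (ext_circ x z) y - ext_circ x (ext_circ z y).
Proof.
(* The fibre of each side separates into a part that depends only on the bases, settled by [alphaP],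
   and a part acting on the fibre of x, settled by [rhoP]. *)
have reorder (a b c d e : W) : a + (b + c) - (d + e) = (a + b - d) + (c - e).
  by rewrite opprD (addrA a) addrACA.
have pairE (p q : E) : p.1 = q.1 -> p.2 = q.2 -> p = q.
  by case: p q => [p1 p2] [q1 q2] /= -> ->.
apply: pairE; first exact: (circ_prelie x.1 y.1 z.1).
have distr (s t : W) (p : P) : rho (s + t) p = rho s p + rho t p.
  exact: linearDl.
change ((alpha (x.1 ∘ y.1) z.1 + rho (alpha x.1 y.1 + rho x.2 y.1) z.1) -
   (alpha x.1 (y.1 ∘ z.1) + rho x.2 (y.1 ∘ z.1)) =
   (alpha (x.1 ∘ z.1) y.1 + rho (alpha x.1 z.1 + rho x.2 z.1) y.1) -
   (alpha x.1 (z.1 ∘ y.1) + rho x.2 (z.1 ∘ y.1))).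
by rewrite !distr !reorder alphaP rhoP.
Qed.
HB.instance Definition _ :=
  isPreLie.Build K E ext_circ_bilinear ext_circ_prelie.

End Extension.

Section Projections.
Variables (K : fieldType) (A B P : preLieType K) (W : lmodType K).
Variables (alpha : {bilinear P -> P -> W}) (rho : {bilinear W -> P -> W}).
Variables (alphaP : ext_alpha_axiom alpha rho) (rhoP : ext_rho_axiom rho).

Definition pfst (p : A * B) : A := p.1.
Fact pfst_linear : linear pfst. Proof. by []. Qed.
HB.instance Definition _ := GRing.isLinear.Build K (A * B)%type A *:%R pfst pfst_linear.
Fact pfst_circM : {morph pfst : x y / x ∘ y}. Proof. by []. Qed.
HB.instance Definition _ := isPreLieHom.Build K (A * B)%type A pfst pfst_circM.

Definition psnd (p : A * B) : B := p.2.
Fact psnd_linear : linear psnd. Proof. by []. Qed.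
HB.instance Definition _ := GRing.isLinear.Build K (A * B)%type B *:%R psnd psnd_linear.
Fact psnd_circM : {morph psnd : x y / x ∘ y}. Proof. by []. Qed.
HB.instance Definition _ := isPreLieHom.Build K (A * B)%type B psnd psnd_circM.

Definition ext_base (p : extension alphaP rhoP) : P := p.1.
Fact ext_base_linear : linear ext_base. Proof. by []. Qed.
HB.instance Definition _ :=
  GRing.isLinear.Build K (extension alphaP rhoP) P *:%R ext_base ext_base_linear.
Fact ext_base_circM : {morph ext_base : x y / x ∘ y}. Proof. by []. Qed.
HB.instance Definition _ :=
  isPreLieHom.Build K (extension alphaP rhoP) P ext_base ext_base_circM.

Definition ext_fib (p : extension alphaP rhoP) : W := p.2.
Fact ext_fib_linear : linear ext_fib. Proof. by []. Qed.
HB.instance Definition _ :=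
  GRing.isLinear.Build K (extension alphaP rhoP) W *:%R ext_fib ext_fib_linear.

End Projections.

Arguments pfst {K A B} p.
Arguments psnd {K A B} p.

Section Actions.
Variables (K : fieldType) (P : preLieType K).

Definition ract (W : lmodType K) (rho : W -> P -> W) p w := rho w p.
Fact ract_linear W (rho : {bilinear W -> P -> W}) p : linear (ract rho p).
Proof. by move=> c u v; rewrite /ract linearDl linearZl_LR. Qed.
HB.instance Definition _ W (rho : {bilinear W -> P -> W}) p :=
  GRing.isLinear.Build K W W *:%R (ract rho p) (ract_linear rho p).

Section Hom.
Variables (A : preLieType K) (h : preLieHom P A).
Definition hact (a : A) (p : P) : A := a ∘ h p.
Fact hact_bilinear : bilinear_for *:%R *:%R hact.
Proof. by split=> [p|a] c u v; rewrite /hact ?linearP ?circPl ?circPr. Qed.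
HB.instance Definition _ :=
  bilinear_isBilinear.Build K A P A *:%R *:%R hact hact_bilinear.
(** This is the pre-Lie identity of A, its first argument being read as the vector acted upon. *)
Lemma hact_axiom : ext_rho_axiom hact.
Proof.
have e u p q : hact (hact u p) q - hact u (p ∘ q) =
    (u ∘ h p) ∘ h q - u ∘ (h p ∘ h q) by rewrite /hact circM.
by move=> s y z; rewrite /= !e circ_prelie.
Qed.
End Hom.

Section Tens.
Variables W1 W2 : lmodType K.
Variables (rho1 : {bilinear W1 -> P -> W1}) (rho2 : {bilinear W2 -> P -> W2}).

Fact tens_act_key : unit. Proof. exact: tt. Qed.
(* Locked, since otherwise rewriting with additivity lemmas unfolds it. *)
Definition tens_act : tensor W1 W2 -> P -> tensor W1 W2 :=
  locked_with tens_act_key (fun t p =>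
    tmap (ract rho1 p) idfun t + tmap idfun (ract rho2 p) t).

Lemma tens_actE t p :
  tens_act t p = tmap (ract rho1 p) idfun t + tmap idfun (ract rho2 p) t.
Proof. by rewrite /tens_act unlock. Qed.

Lemma tens_act_tens a b p : tens_act (a ⊗ b) p = rho1 a p ⊗ b + a ⊗ rho2 b p.
Proof. by rewrite tens_actE !tmap_tens. Qed.

Fact tens_act_linearl p : linear (tens_act^~ p).
Proof. by move=> c u v; rewrite /= !tens_actE !linearP /= scalerDr addrACA. Qed.

Lemma tens_actD t u p : tens_act (t + u) p = tens_act t p + tens_act u p.
Proof. by have := tens_act_linearl p 1 t u; rewrite !scale1r. Qed.
Lemma tens_act0 p : tens_act 0 p = 0.
Proof. by rewrite tens_actE !linear0 addr0. Qed.

Fact tens_act_bilinear : bilinear_for *:%R *:%R tens_act.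
Proof.
split=> [p|t] c u v; first exact: tens_act_linearl.
elim/tensor_ind: t => [|a b t IH]; first by rewrite /= !tens_act0 scaler0 addr0.
have e : tens_act (a ⊗ b) (c *: u + v) =
    c *: tens_act (a ⊗ b) u + tens_act (a ⊗ b) v.
  rewrite !tens_act_tens.
  rewrite [rho1 a _]linearDr [rho2 b _]linearDr /= !linearZr_LR /= tensPl tensPr.
  by rewrite scalerDr addrACA.
by move: IH => /= IH; rewrite !tens_actD IH e [in RHS]scalerDr addrACA.
Qed.
HB.instance Definition _ := bilinear_isBilinear.Build K (tensor W1 W2) P
  (tensor W1 W2) *:%R *:%R tens_act tens_act_bilinear.

(** As for Lie modules, the Leibniz action inherits the axiom: besides the defects of the two
    factors only cross terms appear, and they are symmetric in the acting elements. *)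
Lemma tens_act_axiom :
  ext_rho_axiom rho1 -> ext_rho_axiom rho2 -> ext_rho_axiom tens_act.
Proof.
move=> h1 h2 s y z; elim/tensor_ind: s => [|a b t IH].
  by rewrite /= !tens_act0 subr0.
have sub1 u v : u ⊗ b - v ⊗ b = (u - v) ⊗ b by rewrite linearBl.
have sub2 u v : a ⊗ u - a ⊗ v = a ⊗ (u - v) by rewrite linearBr.
have e p q : tens_act (tens_act (a ⊗ b) p) q - tens_act (a ⊗ b) (p ∘ q) =
    (rho1 (rho1 a p) q - rho1 a (p ∘ q)) ⊗ b
    + a ⊗ (rho2 (rho2 b p) q - rho2 b (p ∘ q))
    + (rho1 a p ⊗ rho2 b q + rho1 a q ⊗ rho2 b p).
  rewrite tens_act_tens tens_actD !tens_act_tens -sub1 -sub2.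
  by rewrite opprD (AC (2*2*2)%AC ((1*5)*(4*6)*(2*3))%AC).
have e2 p q : tens_act (tens_act (a ⊗ b + t) p) q - tens_act (a ⊗ b + t) (p ∘ q) =
    (tens_act (tens_act (a ⊗ b) p) q - tens_act (a ⊗ b) (p ∘ q))
    + (tens_act (tens_act t p) q - tens_act t (p ∘ q)).
  by rewrite !tens_actD [in LHS]opprD [LHS]addrACA.
rewrite /= !e2; congr (_ + _); last exact: IH.
by rewrite !e h1 h2; congr (_ + _); rewrite addrC.
Qed.

End Tens.
End Actions.

(** * From cogroups to coproducts *)

Section Mixed.
Variables (K : fieldType) (A B : preLieType K).

Definition mixed_rho : tensor A B -> A * B -> tensor A B :=
  tens_act (hact pfst) (hact psnd).
HB.instance Definition _ := Bilinear.on mixed_rho.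

Lemma mixed_rho_tens a b p : mixed_rho (a ⊗ b) p = (a ∘ p.1) ⊗ b + a ⊗ (b ∘ p.2).
Proof. exact: tens_act_tens. Qed.
Lemma mixed_rhoD s t p : mixed_rho (s + t) p = mixed_rho s p + mixed_rho t p.
Proof. exact: linearDl. Qed.
Lemma mixed_rho0 p : mixed_rho 0 p = 0.
Proof. exact: linear0l. Qed.
Lemma mixed_rhoP : ext_rho_axiom mixed_rho.
Proof. by apply: tens_act_axiom; apply: hact_axiom. Qed.

(** Only an A-component followed by a B-component contributes, so that A and B both embed with zero
    fibre. *)
Definition mixed_alpha (p q : A * B) : tensor A B := p.1 ⊗ q.2.
Fact mixed_alpha_bilinear : bilinear_for *:%R *:%R mixed_alpha.
Proof. by split=> [p|p] c u v; rewrite /mixed_alpha /= ?tensPl ?tensPr. Qed.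
HB.instance Definition _ := bilinear_isBilinear.Build K (A * B)%type (A * B)%type
  (tensor A B) *:%R *:%R mixed_alpha mixed_alpha_bilinear.

Lemma mixed_alphaP : ext_alpha_axiom mixed_alpha mixed_rho.
Proof.
(* Once x.1 ⊗ (y.2 ∘ z.2) cancels, the remainder is symmetric in y and z. *)
have e (x y z : A * B) : mixed_alpha (x ∘ y) z + mixed_rho (mixed_alpha x y) z
    - mixed_alpha x (y ∘ z) = (x.1 ∘ y.1) ⊗ z.2 + (x.1 ∘ z.1) ⊗ y.2.
  by rewrite mixed_rho_tens addrA addrK.
by move=> x y z; rewrite !e addrC.
Qed.

Definition mixed := extension mixed_alphaP mixed_rhoP.
HB.instance Definition _ := PreLie.on mixed.

Definition mbase : mixed -> A * B := @ext_base _ _ _ _ _ mixed_alphaP mixed_rhoP.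
HB.instance Definition _ := PreLieHom.on mbase.
Definition mfib : mixed -> tensor A B := @ext_fib _ _ _ _ _ mixed_alphaP mixed_rhoP.
HB.instance Definition _ := GRing.Linear.on mfib.

Lemma mfib_circ p q :
  mfib (p ∘ q) = (mbase p).1 ⊗ (mbase q).2 + mixed_rho (mfib p) (mbase q).
Proof. by []. Qed.

Definition mleft (a : A) : mixed := ((a, 0), 0).
Definition mright (b : B) : mixed := ((0, b), 0).

Lemma mixed_eq (p q : mixed) : mbase p = mbase q -> mfib p = mfib q -> p = q.
Proof. by case: p q => p1 p2 [q1 q2] /= ; rewrite /mbase /mfib /ext_base /ext_fib /= => -> ->. Qed.

Fact mleft_linear : linear mleft.
Proof.
by move=> c u v; congr ((_, _), _); rewrite /= ?scaler0 ?addr0.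
Qed.
HB.instance Definition _ := GRing.isLinear.Build K A mixed *:%R mleft mleft_linear.
Fact mleft_circM : {morph mleft : x y / x ∘ y}.
Proof.
move=> x y; apply: mixed_eq; first by rewrite [RHS]circM; congr (_, _); rewrite /= linear0l.
rewrite mfib_circ /= -[X in _ + X]/(mixed_rho 0 _) linear0l addr0.
by rewrite linear0r.
Qed.
HB.instance Definition _ := isPreLieHom.Build K A mixed mleft mleft_circM.

Fact mright_linear : linear mright.
Proof.
by move=> c u v; congr ((_, _), _); rewrite /= ?scaler0 ?addr0.
Qed.
HB.instance Definition _ := GRing.isLinear.Build K B mixed *:%R mright mright_linear.
Fact mright_circM : {morph mright : x y / x ∘ y}.
Proof.
move=> x y; apply: mixed_eq; first by rewrite [RHS]circM; congr (_, _); rewrite /= linear0l.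
rewrite mfib_circ /= -[X in _ + X]/(mixed_rho 0 _) linear0l add0r.
by rewrite linear0l.
Qed.
HB.instance Definition _ := isPreLieHom.Build K B mixed mright mright_circM.

Definition mcan : coprod A B -> mixed := copair mleft mright.
HB.instance Definition _ := PreLieHom.on mcan.

Lemma mcan_inl a : mcan (inl_pl a) = mleft a. Proof. exact: copair_inl. Qed.
Lemma mcan_inr b : mcan (inr_pl b) = mright b. Proof. exact: copair_inr. Qed.

Lemma mbase_mcan q : mbase (mcan q) = (coprod_proj1 q, coprod_proj2 q).
Proof.
elim/coprod_ind: q => [a|b|c x y hx hy|x y hx hy].
- by rewrite mcan_inl /coprod_proj1 /coprod_proj2 !copair_inl.
- by rewrite mcan_inr /coprod_proj1 /coprod_proj2 !copair_inr.
- by rewrite !linearP /= hx hy.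
- rewrite [mcan _]circM [mbase _]circM /= hx hy.
  by rewrite [coprod_proj1 (_ ∘ _)]circM [coprod_proj2 (_ ∘ _)]circM.
Qed.

End Mixed.

(** * A second extension, with fibre A ⊗ B ⊗ C *)

Section Triple.
Variables (K : fieldType) (A B C : preLieType K).
Local Notation M := (mixed A (B * C)%type).

Definition mA (m : M) : A := (mbase m).1.
Definition mB (m : M) : B := (mbase m).2.1.
Definition mC (m : M) : C := (mbase m).2.2.
Fact mA_linear : linear mA. Proof. by []. Qed.
Fact mB_linear : linear mB. Proof. by []. Qed.
Fact mC_linear : linear mC. Proof. by []. Qed.
HB.instance Definition _ := GRing.isLinear.Build K M A *:%R mA mA_linear.
HB.instance Definition _ := GRing.isLinear.Build K M B *:%R mB mB_linear.
HB.instance Definition _ := GRing.isLinear.Build K M C *:%R mC mC_linear.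
Fact mA_circM : {morph mA : x y / x ∘ y}. Proof. by []. Qed.
Fact mB_circM : {morph mB : x y / x ∘ y}. Proof. by []. Qed.
Fact mC_circM : {morph mC : x y / x ∘ y}. Proof. by []. Qed.
HB.instance Definition _ := isPreLieHom.Build K M A mA mA_circM.
HB.instance Definition _ := isPreLieHom.Build K M B mB mB_circM.
HB.instance Definition _ := isPreLieHom.Build K M C mC mC_circM.

Definition rho12 : tensor A B -> M -> tensor A B := tens_act (hact mA) (hact mB).
HB.instance Definition _ := Bilinear.on rho12.
Definition rho13 : tensor A C -> M -> tensor A C := tens_act (hact mA) (hact mC).
HB.instance Definition _ := Bilinear.on rho13.
Definition triple_rho :
    tensor (tensor A B) C -> M -> tensor (tensor A B) C :=
  tens_act rho12 (hact mC).
HB.instance Definition _ := Bilinear.on triple_rho.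

Lemma triple_rhoP : ext_rho_axiom triple_rho.
Proof.
by apply: tens_act_axiom; [apply: tens_act_axiom|]; apply: hact_axiom.
Qed.

Lemma rho12_tens a b m : rho12 (a ⊗ b) m = (a ∘ mA m) ⊗ b + a ⊗ (b ∘ mB m).
Proof. exact: tens_act_tens. Qed.
Lemma rho13_tens a c m : rho13 (a ⊗ c) m = (a ∘ mA m) ⊗ c + a ⊗ (c ∘ mC m).
Proof. exact: tens_act_tens. Qed.
Lemma triple_rho_tens t c m :
  triple_rho (t ⊗ c) m = rho12 t m ⊗ c + t ⊗ (c ∘ mC m).
Proof. exact: tens_act_tens. Qed.
Lemma rho12D s t m : rho12 (s + t) m = rho12 s m + rho12 t m.
Proof. exact: linearDl. Qed.
Lemma rho120 m : rho12 0 m = 0.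
Proof. exact: linear0l. Qed.
Lemma rho13D s t m : rho13 (s + t) m = rho13 s m + rho13 t m.
Proof. exact: linearDl. Qed.
Lemma rho130 m : rho13 0 m = 0.
Proof. exact: linear0l. Qed.
Lemma triple_rhoD s t m : triple_rho (s + t) m = triple_rho s m + triple_rho t m.
Proof. exact: linearDl. Qed.
Lemma triple_rho0 m : triple_rho 0 m = 0.
Proof. exact: linear0l. Qed.

(** The fibre A ⊗ (B × C) of M splits as A ⊗ B plus A ⊗ C; [fib12] and [fib13] are its two parts. *)
Definition fib12 (m : M) : tensor A B := tmap idfun pfst (mfib m).
Fact fib12_linear : linear fib12.
Proof. by move=> c u v; rewrite /fib12 !linearP. Qed.
HB.instance Definition _ :=
  GRing.isLinear.Build K M (tensor A B) *:%R fib12 fib12_linear.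
Definition fib13 (m : M) : tensor A C := tmap idfun psnd (mfib m).
Fact fib13_linear : linear fib13.
Proof. by move=> c u v; rewrite /fib13 !linearP. Qed.
HB.instance Definition _ :=
  GRing.isLinear.Build K M (tensor A C) *:%R fib13 fib13_linear.

Lemma fib12_circ m n : fib12 (m ∘ n) = mA m ⊗ mB n + rho12 (fib12 m) n.
Proof.
rewrite /fib12 mfib_circ tmapD tmap_tens; congr (_ + _).
elim/tensor_ind: (mfib m) => [|a b t IH].
  by rewrite mixed_rho0 tmap0 rho120.
rewrite mixed_rhoD !tmapD IH rho12D; congr (_ + _).
by rewrite mixed_rho_tens tmapD !tmap_tens rho12_tens.
Qed.

Lemma fib13_circ m n : fib13 (m ∘ n) = mA m ⊗ mC n + rho13 (fib13 m) n.
Proof.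
rewrite /fib13 mfib_circ tmapD tmap_tens; congr (_ + _).
elim/tensor_ind: (mfib m) => [|a b t IH].
  by rewrite mixed_rho0 tmap0 rho130.
rewrite mixed_rhoD !tmapD IH rho13D; congr (_ + _).
by rewrite mixed_rho_tens tmapD !tmap_tens rho13_tens.
Qed.

Lemma triple_rho_tau23 (t : tensor A C) b m :
  triple_rho (tau23 (t ⊗ b)) m =
  tau23 (rho13 t m ⊗ b) + tau23 (t ⊗ (b ∘ mB m)).
Proof.
elim/tensor_ind: t => [|a c t IH].
  by rewrite rho130 !tens0l tau230 triple_rho0 addr0.
rewrite rho13D !tensDl !tau23D triple_rhoD IH addrACA; congr (_ + _).
rewrite rho13_tens tensDl tau23D !tau23_tens triple_rho_tens rho12_tens.
by rewrite tensDl addrAC.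
Qed.

(** The two ways to complete a tensor in A ⊗ B ⊗ C: a fibre in A ⊗ B meets C, or a fibre in A ⊗ C
    meets B and [tau23] restores the order. *)
Definition triple_alpha (m n : M) : tensor (tensor A B) C :=
  fib12 m ⊗ mC n + tau23 (fib13 m ⊗ mB n).
Fact triple_alpha_bilinear : bilinear_for *:%R *:%R triple_alpha.
Proof.
split=> [n|m] c u v; rewrite /triple_alpha.
  rewrite fib12_linear fib13_linear !tensPl linearP /=.
  by rewrite scalerDr addrACA.
rewrite mB_linear mC_linear !tensPr linearP /=.
by rewrite scalerDr addrACA.
Qed.
HB.instance Definition _ := bilinear_isBilinear.Build K M M
  (tensor (tensor A B) C) *:%R *:%R triple_alpha triple_alpha_bilinear.

Lemma triple_alphaP : ext_alpha_axiom triple_alpha triple_rho.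
Proof.
(* The terms containing products of y and z in B or C cancel; the others form three pairs exchanged
   by y and z. *)
have e x y z : triple_alpha (x ∘ y) z + triple_rho (triple_alpha x y) z
      - triple_alpha x (y ∘ z) =
    (mA x ⊗ mB y ⊗ mC z + mA x ⊗ mB z ⊗ mC y)
    + (rho12 (fib12 x) y ⊗ mC z + rho12 (fib12 x) z ⊗ mC y)
    + (tau23 (rho13 (fib13 x) y ⊗ mB z) + tau23 (rho13 (fib13 x) z ⊗ mB y)).
  rewrite /triple_alpha fib12_circ fib13_circ mB_circM mC_circM.
  rewrite triple_rhoD triple_rho_tens triple_rho_tau23 !tensDl tau23D.
  rewrite tau23_tens.
  set a1 := mA x ⊗ mB y ⊗ mC z; set a2 := rho12 _ y ⊗ _.
  set a3 := mA x ⊗ mB z ⊗ mC y; set a4 := tau23 (rho13 _ y ⊗ _).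
  set a5 := rho12 _ z ⊗ _; set a6 := fib12 x ⊗ _; set a7 := tau23 (rho13 _ z ⊗ _).
  set a8 := tau23 (fib13 x ⊗ _).
  rewrite (AC (((2*2)*(2*2))*1)%AC (((1*3)*(2*5)*(4*7))*((6*8)*9))%AC).
  by rewrite /= subrr addr0.
by move=> x y z; rewrite !e; congr (_ + _ + _); rewrite addrC.
Qed.

Definition triple := extension triple_alphaP triple_rhoP.
HB.instance Definition _ := PreLie.on triple.

Definition tbase : triple -> M := @ext_base _ _ _ _ _ triple_alphaP triple_rhoP.
HB.instance Definition _ := PreLieHom.on tbase.
Definition tfib : triple -> tensor (tensor A B) C :=
  @ext_fib _ _ _ _ _ triple_alphaP triple_rhoP.
HB.instance Definition _ := GRing.Linear.on tfib.

Lemma tfib_circ p q :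
  tfib (p ∘ q) = triple_alpha (tbase p) (tbase q) + triple_rho (tfib p) (tbase q).
Proof. by []. Qed.

Lemma triple_eq (p q : triple) : tbase p = tbase q -> tfib p = tfib q -> p = q.
Proof.
by case: p q => p1 p2 [q1 q2]; rewrite /tbase /tfib /ext_base /ext_fib /= => -> ->.
Qed.

End Triple.

Section TripleCanonical.
Variables (K : fieldType) (A B C : preLieType K).
Local Notation M := (mixed A (B * C)%type).
Local Notation T := (triple A B C).

Definition tbare (m : M) : T := (m, 0).
Fact tbare_linear : linear tbare.
Proof. by move=> c u v; congr (_, _); rewrite /= scaler0 addr0. Qed.

(** When m has no fibre in M, both the cocycle and the action on the zero fibre vanish, so the zero
    section is multiplicative there. *)
Lemma tbare_circ (m n : M) : mfib m = 0 -> tbare (m ∘ n) = tbare m ∘ tbare n.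
Proof.
move=> m0; apply: triple_eq => //.
rewrite tfib_circ /triple_alpha /= /fib12 /fib13 m0 !tmap0 !tens0l tau230.
by rewrite triple_rho0 !addr0.
Qed.

Definition tleft (a : A) : T := tbare (mleft _ a).
Fact tleft_linear : linear tleft.
Proof. by move=> c u v; rewrite /tleft mleft_linear tbare_linear. Qed.
HB.instance Definition _ := GRing.isLinear.Build K A T *:%R tleft tleft_linear.
Fact tleft_circM : {morph tleft : x y / x ∘ y}.
Proof. by move=> x y; rewrite /tleft mleft_circM tbare_circ. Qed.
HB.instance Definition _ := isPreLieHom.Build K A T tleft tleft_circM.

Definition cproj (q : coprod B C) : B * C := (coprod_proj1 q, coprod_proj2 q).
Fact cproj_linear : linear cproj.
Proof. by move=> c u v; congr (_, _); rewrite /= linearP. Qed.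
Fact cproj_circM : {morph cproj : x y / x ∘ y}.
Proof. by move=> x y; congr (_, _); rewrite /= circM. Qed.

(** The algebra B ∨ C enters through B × C only, which kills products mixing B and C. *)
Definition tright (q : coprod B C) : T := tbare (mright _ (cproj q)).
Fact tright_linear : linear tright.
Proof. by move=> c u v; rewrite /tright cproj_linear mright_linear tbare_linear. Qed.
HB.instance Definition _ :=
  GRing.isLinear.Build K (coprod B C) T *:%R tright tright_linear.
Fact tright_circM : {morph tright : x y / x ∘ y}.
Proof. by move=> x y; rewrite /tright cproj_circM mright_circM tbare_circ. Qed.
HB.instance Definition _ := isPreLieHom.Build K (coprod B C) T tright tright_circM.

Definition tcan : coprod A (coprod B C) -> T := copair tleft tright.
HB.instance Definition _ := PreLieHom.on tcan.

Lemma tcan_inl a : tcan (inl_pl a) = tleft a. Proof. exact: copair_inl. Qed.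
Lemma tcan_inr q : tcan (inr_pl q) = tright q. Proof. exact: copair_inr. Qed.

End TripleCanonical.

Section Components.
Variables (K : fieldType) (A B C : preLieType K).
Local Notation T := (triple A B C).

(** All coordinates of an element of [triple]. The formula for a product uses them jointly, so the
    inductions below carry the whole tuple even when only the last entry is wanted. *)
Definition components (r : T) a b c s12 s13 w :=
  [/\ mA (tbase r) = a, mB (tbase r) = b, mC (tbase r) = c,
      fib12 (tbase r) = s12 & fib13 (tbase r) = s13 /\ tfib r = w].

Lemma components_lin k r1 a1 b1 c1 s1 t1 w1 r2 a2 b2 c2 s2 t2 w2 :
  components r1 a1 b1 c1 s1 t1 w1 -> components r2 a2 b2 c2 s2 t2 w2 ->
  components (k *: r1 + r2) (k *: a1 + a2) (k *: b1 + b2) (k *: c1 + c2)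
    (k *: s1 + s2) (k *: t1 + t2) (k *: w1 + w2).
Proof.
case=> <- <- <- <- [<- <-] [<- <- <- <- [<- <-]].
by split=> //; rewrite -?fib12_linear -?fib13_linear //.
Qed.

Lemma components_circ r1 a1 b1 c1 s1 t1 w1 r2 a2 b2 c2 s2 t2 w2 :
  components r1 a1 b1 c1 s1 t1 w1 -> components r2 a2 b2 c2 s2 t2 w2 ->
  components (r1 ∘ r2) (a1 ∘ a2) (b1 ∘ b2) (c1 ∘ c2)
    (a1 ⊗ b2 + (tmap (rmul a2) idfun s1 + tmap idfun (rmul b2) s1))
    (a1 ⊗ c2 + (tmap (rmul a2) idfun t1 + tmap idfun (rmul c2) t1))
    (s1 ⊗ c2 + tau23 (t1 ⊗ b2)
     + (tmap (tmap (rmul a2) idfun) idfun w1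
        + tmap (tmap idfun (rmul b2)) idfun w1 + tmap idfun (rmul c2) w1)).
Proof.
case=> <- <- <- <- [<- <-] [<- <- <- _ _]; split=> //.
- rewrite -[tbase (r1 ∘ r2)]/(tbase r1 ∘ tbase r2) fib12_circ; congr (_ + _).
  by rewrite /rho12 tens_actE.
split.
  rewrite -[tbase (r1 ∘ r2)]/(tbase r1 ∘ tbase r2) fib13_circ; congr (_ + _).
  by rewrite /rho13 tens_actE.
rewrite tfib_circ /triple_alpha; congr (_ + _).
elim/tensor_ind: (tfib r1) => [|t c w IH]; first by rewrite triple_rho0 !tmap0 !addr0.
rewrite triple_rhoD IH triple_rho_tens !tmapD !tmap_tens /rho12 tens_actE tensDl.
rewrite addrACA; congr (_ + _).
by rewrite addrACA.
Qed.

End Components.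

Lemma tau23_tmap (K : fieldType) (A B C A' B' C' : lmodType K)
    (f : {linear A -> A'}) (g : {linear B -> B'}) (h : {linear C -> C'}) w :
  tau23 (tmap (tmap f g) h w) = tmap (tmap f h) g (tau23 w).
Proof.
elim/tensor_ind: w => [|t c w IH]; first by rewrite !(tmap0, tau230).
rewrite !(tmapD, tau23D) IH; congr (_ + _); rewrite tmap_tens /=.
elim/tensor_ind: t => [|a b t {}IH]; first by rewrite !(tmap0, tens0l, tau230).
by rewrite tmapD !tensDl !tau23D IH tmapD !(tmap_tens, tau23_tens) /= tmap_tens.
Qed.

Lemma tau23K (K : fieldType) (A B C : lmodType K) (w : tensor (tensor A B) C) :
  tau23 (tau23 w) = w.
Proof.
elim/tensor_ind: w => [|t c w IH]; first by rewrite !tau230.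
rewrite !tau23D IH; congr (_ + _).
elim/tensor_ind: t => [|a b t {}IH]; first by rewrite !(tens0l, tau230).
by rewrite !(tensDl, tau23D) IH !tau23_tens.
Qed.

Lemma mfib_mleft (K : fieldType) (A B : preLieType K) (a : A) : mfib (mleft B a) = 0.
Proof. by []. Qed.
Lemma mfib_mright (K : fieldType) (A B : preLieType K) (b : B) : mfib (mright A b) = 0.
Proof. by []. Qed.

Lemma mfib_mcan_circ (K : fieldType) (A B : preLieType K) (p q : coprod A B) :
  mfib (mcan (p ∘ q)) = coprod_proj1 p ⊗ coprod_proj2 q
    + (tmap (rmul (coprod_proj1 q)) idfun (mfib (mcan p))
       + tmap idfun (rmul (coprod_proj2 q)) (mfib (mcan p))).
Proof.
rewrite [mcan _]circM mfib_circ !mbase_mcan; congr (_ + _).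
by rewrite /mixed_rho tens_actE.
Qed.

(** * The coproduct of a cogroup map and its permutativity *)

Section Codelta.
Variables (K : fieldType) (L : preLieType K) (phi : preLieHom L (coprod L L)).

Definition codelta (x : L) : tensor L L := mfib (mcan (phi x)).
Fact codelta_linear : linear codelta.
Proof. by move=> c u v; rewrite /codelta !linearP. Qed.
HB.instance Definition _ :=
  GRing.isLinear.Build K L (tensor L L) *:%R codelta codelta_linear.

Hypothesis proj1_phi : forall x, coprod_proj1 (phi x) = x.
Hypothesis proj2_phi : forall x, coprod_proj2 (phi x) = x.

(** The tensor x ⊗ y comes from the first projection of [phi x] and the second of [phi y], both
    identities for a cogroup; the rest is the Leibniz action on the fibre. *)
Lemma codeltaM x y : codelta (x ∘ y) = x ⊗ y + tact y (codelta x).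
Proof. by rewrite /codelta circM mfib_mcan_circ !proj1_phi proj2_phi tactE. Qed.

(** The term with [tau23] accounts for the a ⊗ y that [codeltaM] creates inside the first factor. *)
Lemma tmap_codelta_act (s : tensor L L) (y z : L) :
  tau23 (s ⊗ y)
  + (tmap (tmap (rmul y) idfun) idfun (tmap codelta idfun s)
     + tmap (tmap idfun (rmul y)) idfun (tmap codelta idfun s)
     + tmap idfun (rmul z) (tmap codelta idfun s))
  = tmap codelta idfun (tmap (rmul y) idfun s + tmap idfun (rmul z) s).
Proof.
elim/tensor_ind: s => [|a b t IH]; first by rewrite tens0l tau230 !tmap0 !addr0 tmap0.
rewrite tensDl tau23D !tmapD !tmap_tens /= -[rmul y a]/(a ∘ y) codeltaM tactE.
rewrite tmapD in IH; rewrite !tensDl tau23_tens.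
rewrite [LHS](AC ((2*(2*2*2))%AC) ((1*(3*5)*7)*(2*(4*6*8)))%AC) /= IH.
by rewrite addrACA.
Qed.

Lemma components_tleft (A B C : preLieType K) (a : A) :
  components (tleft B C a) a 0 0 0 0 0.
Proof. by split=> //; [apply: tmap0|split=> //; apply: tmap0]. Qed.
Lemma components_tright (A B C : preLieType K) (q : coprod B C) :
  components (tright A q) 0 (coprod_proj1 q) (coprod_proj2 q) 0 0 0.
Proof. by split=> //; [apply: tmap0|split=> //; apply: tmap0]. Qed.

Lemma components_inl (A B C : preLieType K) (p : coprod A B) :
  components (tcan (coprod_assoc (inl_pl p : coprod (coprod A B) C)))
    (coprod_proj1 p) (coprod_proj2 p) 0 (mfib (mcan p)) 0 0.
Proof.
rewrite /coprod_assoc copair_inl /=.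
elim/coprod_ind: p => [a|b|c x y hx hy|x y hx hy].
- rewrite copair_inl tcan_inl mcan_inl /coprod_proj1 /coprod_proj2 !copair_inl.
  exact: components_tleft.
- rewrite copair_inr /= tcan_inr mcan_inr /coprod_proj1 /coprod_proj2 !copair_inr.
  have := components_tright A (inl_pl b : coprod B C).
  by rewrite /coprod_proj1 /coprod_proj2 !copair_inl.
- have := components_lin c hx hy; rewrite !linearP /=.
  by rewrite !scaler0 !addr0.
have := components_circ hx hy.
rewrite [copair _ _ (x ∘ y)]circM [tcan (_ ∘ _)]circM mfib_mcan_circ.
rewrite [coprod_proj1 (x ∘ y)]circM [coprod_proj2 (x ∘ y)]circM /=.
by rewrite linear0l !tmap0 !tens0r tens0l tau230 !addr0.
Qed.

(** At q = [phi x] the last coordinate becomes (Delta ⊗ Id) Delta x. *)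
Lemma components_map_phil (q : coprod L L) :
  components (tcan (coprod_assoc (coprod_map phi idfun q)))
    (coprod_proj1 q) (coprod_proj1 q) (coprod_proj2 q)
    (codelta (coprod_proj1 q)) (mfib (mcan q)) (tmap codelta idfun (mfib (mcan q))).
Proof.
elim/coprod_ind: q => [a|b|c x y hx hy|x y hx hy].
- rewrite /coprod_map copair_inl /= mcan_inl.
  have := components_inl L (phi a); rewrite proj1_phi proj2_phi.
  by rewrite /coprod_proj1 /coprod_proj2 !copair_inl mfib_mleft tmap0.
- rewrite /coprod_map copair_inr /= mcan_inr /coprod_assoc copair_inr tcan_inr.
  have := components_tright L (inr_pl b : coprod L L).
  rewrite /coprod_proj1 /coprod_proj2 !copair_inr mfib_mright tmap0 /=.
  by rewrite linear0.
- have := components_lin c hx hy; rewrite !linearP /=.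
  by rewrite -codelta_linear.
have := components_circ hx hy.
rewrite [coprod_map _ _ (x ∘ y)]circM [coprod_assoc (_ ∘ _)]circM [tcan (_ ∘ _)]circM.
rewrite mfib_mcan_circ.
rewrite [coprod_proj1 (x ∘ y)]circM [coprod_proj2 (x ∘ y)]circM /= codeltaM tactE.
congr components.
by rewrite [in RHS]tmapD tmap_tens /= -addrA; congr (_ + _); apply: tmap_codelta_act.
Qed.

(** Since [tright] sees [phi b] only through its two projections, both equal to b, the roles of B
    and C are interchangeable; hence the fibre is fixed by [tau23]. *)
Lemma components_map_phir (q : coprod L L) : exists2 w,
  components (tcan (coprod_map idfun phi q))
    (coprod_proj1 q) (coprod_proj2 q) (coprod_proj2 q)
    (mfib (mcan q)) (mfib (mcan q)) w & tau23 w = w.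
Proof.
elim/coprod_ind: q => [a|b|c x y [w hw ew] [w' hw' ew']|x y [w hw ew] [w' hw' ew']].
- exists 0; last exact: tau230.
  rewrite /coprod_map copair_inl /= tcan_inl mcan_inl mfib_mleft.
  rewrite /coprod_proj1 /coprod_proj2 !copair_inl.
  exact: components_tleft.
- exists 0; last exact: tau230.
  rewrite /coprod_map copair_inr /= tcan_inr mcan_inr mfib_mright.
  have := components_tright L (phi b).
  by rewrite proj1_phi proj2_phi /coprod_proj1 /coprod_proj2 !copair_inr.
- exists (c *: w + w'); last by rewrite linearP /= ew ew'.
  by have := components_lin c hw hw'; rewrite !linearP.
have := components_circ hw hw'.
set w2 := _ + _ + (_ + _ + _); exists w2.
  rewrite [coprod_map _ _ (x ∘ y)]circM [tcan (_ ∘ _)]circM.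
  rewrite mfib_mcan_circ.
  by rewrite [coprod_proj1 (x ∘ y)]circM [coprod_proj2 (x ∘ y)]circM.
have idt (t : tensor (tensor L L) L) : tmap idfun (rmul (coprod_proj2 y)) t
    = tmap (tmap idfun idfun) (rmul (coprod_proj2 y)) t.
  by apply: tmap_ext => // u; rewrite /= tmap_id.
(* The two cocycle terms are exchanged by [tau23], as are the actions on the second and third
   factors; the action on the first factor is preserved. *)
rewrite /w2 !tau23D tau23K (addrC (tau23 _)) -!addrA; congr (_ + (_ + _)).
rewrite idt !tau23_tmap ew; congr (_ + _); rewrite addrC -!idt; congr (_ + _).
Qed.

Hypothesis coassoc_phi : forall x,
  coprod_assoc (coprod_map phi idfun (phi x)) = coprod_map idfun phi (phi x).

Lemma codelta_nap : nap_coproduct codelta.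
Proof.
(* Coassociativity identifies the fibres of the two sides: one is (Delta ⊗ Id) Delta x, the other is
   fixed by [tau23]. *)
move=> x; have [_ _ _ _ [_ e1]] := components_map_phil (phi x).
have [w [_ _ _ _ [_ e2]] ew] := components_map_phir (phi x).
have e : tmap codelta idfun (codelta x) = w by rewrite -e2 -coassoc_phi e1.
by rewrite [tmap _ _ _]e ew subrr.
Qed.

End Codelta.

(** * The cogroup structure of a free pre-Lie algebra *)

Section CoproductEquations.
Variables (K : fieldType) (A B C A' B' : preLieType K).
Variables (f : preLieHom A A') (g : preLieHom B B').
Lemma coprod_map_inl a : coprod_map f g (inl_pl a) = inl_pl (f a).
Proof. exact: copair_inl. Qed.
Lemma coprod_map_inr b : coprod_map f g (inr_pl b) = inr_pl (g b).
Proof. exact: copair_inr. Qed.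
Lemma coprod_assoc_inll a :
  coprod_assoc (inl_pl (inl_pl a)) = inl_pl a :> coprod A (coprod B C).
Proof. by rewrite /coprod_assoc copair_inl /= copair_inl. Qed.
Lemma coprod_assoc_inlr b :
  coprod_assoc (inl_pl (inr_pl b)) = inr_pl (inl_pl b) :> coprod A (coprod B C).
Proof. by rewrite /coprod_assoc copair_inl /= copair_inr. Qed.
Lemma coprod_assoc_inr c :
  coprod_assoc (inr_pl c) = inr_pl (inr_pl c) :> coprod A (coprod B C).
Proof. by rewrite /coprod_assoc copair_inr. Qed.
End CoproductEquations.

Section FreeCogroup.
Variables (K : fieldType) (V : lmodType K) (L : preLieType K).
Variables (f : preLieHom (freePL V) L) (g : L -> freePL V).
Hypotheses (fK : cancel f g) (gK : cancel g f).

(** Reduces each cogroup identity below to generators. *)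
Lemma free_hom_ext (C : preLieType K) (h k : preLieHom L C) :
  (forall v, h (f (fgen v)) = k (f (fgen v))) -> h =1 k.
Proof.
by move=> e x; rewrite -(gK x); apply: (freePL_ext (f := h \o f) (g := k \o f)).
Qed.

Definition cogens (v : V) : coprod L L := inl_pl (f (fgen v)) + inr_pl (f (fgen v)).
Fact cogens_linear : linear cogens.
Proof. by move=> c u v; rewrite /cogens !linearP /= scalerDr addrACA. Qed.
HB.instance Definition _ :=
  GRing.isLinear.Build K V (coprod L L) *:%R cogens cogens_linear.

Definition free_phi of cancel f g & cancel g f := fun x : L => flift cogens (g x).
Local Notation phi := (free_phi fK gK).
Fact free_phi_linear : linear phi.
Proof.
move=> c x y; rewrite /free_phi -linearP; congr flift.
by apply: (can_inj fK); rewrite linearP /= !gK.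
Qed.
HB.instance Definition _ :=
  GRing.isLinear.Build K L (coprod L L) *:%R phi free_phi_linear.
Fact free_phi_circM : {morph phi : x y / x ∘ y}.
Proof.
move=> x y; rewrite /free_phi -circM; congr flift.
by apply: (can_inj fK); rewrite circM /= !gK.
Qed.
HB.instance Definition _ :=
  isPreLieHom.Build K L (coprod L L) phi free_phi_circM.

Lemma free_phi_gen v : phi (f (fgen v)) = inl_pl (f (fgen v)) + inr_pl (f (fgen v)).
Proof. by rewrite /free_phi fK flift_gen. Qed.

Lemma free_phi_proj1 x : coprod_proj1 (phi x) = x.
Proof.
apply: (free_hom_ext (h := coprod_proj1 \o phi) (k := idfun)) => v /=.
by rewrite free_phi_gen /coprod_proj1 linearD /= copair_inl copair_inr /= addr0.
Qed.

Lemma free_phi_proj2 x : coprod_proj2 (phi x) = x.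
Proof.
apply: (free_hom_ext (h := coprod_proj2 \o phi) (k := idfun)) => v /=.
by rewrite free_phi_gen /coprod_proj2 linearD /= copair_inl copair_inr /= add0r.
Qed.

Lemma free_phi_swap x : coprod_swap (phi x) = phi x.
Proof.
apply: (free_hom_ext (h := coprod_swap \o phi) (k := phi)) => v /=.
by rewrite free_phi_gen /coprod_swap linearD /= copair_inl copair_inr addrC.
Qed.

(** On a generator both sides are the sum of its three copies. *)
Lemma free_phi_coassoc x :
  coprod_assoc (coprod_map phi idfun (phi x)) = coprod_map idfun phi (phi x).
Proof.
apply: (free_hom_ext (h := coprod_assoc \o (coprod_map phi idfun \o phi))
  (k := coprod_map idfun phi \o phi)) => v /=.
rewrite free_phi_gen !linearD /= !coprod_map_inl !coprod_map_inr /= !free_phi_gen.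
rewrite !linearD /= coprod_assoc_inll coprod_assoc_inlr coprod_assoc_inr.
by rewrite -addrA.
Qed.

End FreeCogroup.

Lemma free_abelian_cogroup (K : fieldType) (L : gradedPreLieType K) :
  graded_free L -> abelian_cogroup L.
Proof.
case=> V [f [[g fK gK] hf]]; exists (free_phi fK gK : preLieHom L (coprod L L)).
split; last exact: free_phi_swap.
split; [| exact: free_phi_coassoc | exact: free_phi_proj1 | exact: free_phi_proj2].
(* Degrees are read in the free algebra, where [free_homog] offers an induction on how a homogeneous
   element is generated. *)
move=> n x; rewrite -{1}(gK x) => /hf h; rewrite -(gK x).
elim: h => {n} [n|n c y z _ hy _ hz|n y [v hv ->]|m n y z _ hy _ hz].
- by rewrite !linear0; apply: gen_homog0.
- by rewrite !linearP; apply: gen_homogP.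
- rewrite [X in coprod_homog _ X]free_phi_gen -[inl_pl _]scale1r.
  have hv' : homog n (f (fgen v)) by apply/hf; apply: gen_homog_gen; exists v.
  by apply: gen_homogP; apply: gen_homog_gen; [left|right]; exists (f (fgen v)).
- by rewrite !circM; apply: gen_homog_circ.
Qed.

(** * Degrees of the coproduct of a cogroup map *)

Lemma tens_homogD (K : fieldType) (A B : posGradedType K) n (x y : tensor A B) :
  tens_homog n x -> tens_homog n y -> tens_homog n (x + y).
Proof. by move=> hx hy; rewrite -[x]scale1r; apply: tens_homogP. Qed.

Lemma tens_homog_rmull (K : fieldType) (L : gradedPreLieType K) m n
    (s : tensor L L) y : tens_homog m s -> homog n y ->
  tens_homog (m + n) (tmap (rmul y) idfun s).
Proof.
move=> hs hy; elim: hs => {m s} [m|m c s t _ hs _ ht|i j a b ha hb].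
- by rewrite tmap0; apply: tens_homog0.
- by rewrite linearP; apply: tens_homogP.
rewrite tmap_rmull addnAC; apply: tens_homog_tens => //; exact: homog_circ.
Qed.

Lemma tens_homog_rmulr (K : fieldType) (L : gradedPreLieType K) m n
    (s : tensor L L) y : tens_homog m s -> homog n y ->
  tens_homog (m + n) (tmap idfun (rmul y) s).
Proof.
move=> hs hy; elim: hs => {m s} [m|m c s t _ hs _ ht|i j a b ha hb].
- by rewrite tmap0; apply: tens_homog0.
- by rewrite linearP; apply: tens_homogP.
rewrite tmap_rmulr -addnA; apply: tens_homog_tens => //; exact: homog_circ.
Qed.

Lemma mcan_homog (K : fieldType) (L : gradedPreLieType K) n (q : coprod L L) :
  coprod_homog n q -> [/\ homog n (coprod_proj1 q), homog n (coprod_proj2 q)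
    & tens_homog n (mfib (mcan q))].
Proof.
elim=> {n q} [n|n c x y _ [x1 x2 x3] _ [y1 y2 y3]|n x h|m n x y _ [x1 x2 x3] _ [y1 y2 y3]].
- by rewrite !linear0; split; [apply: homog0|apply: homog0|apply: tens_homog0].
- by rewrite !linearP; split; [apply: homogP|apply: homogP|apply: tens_homogP].
- case: h => [[a ha ->]|[a ha ->]]; rewrite /coprod_proj1 /coprod_proj2.
    rewrite !copair_inl mcan_inl; split=> //; [exact: homog0|exact: tens_homog0].
  rewrite !copair_inr mcan_inr; split=> //; [exact: homog0|exact: tens_homog0].
- rewrite [coprod_proj1 (x ∘ y)]circM [coprod_proj2 (x ∘ y)]circM mfib_mcan_circ.
  split; [exact: homog_circ|exact: homog_circ|].
  apply: tens_homogD; first exact: tens_homog_tens.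
  by apply: tens_homogD; [apply: tens_homog_rmull|apply: tens_homog_rmulr].
Qed.

Lemma cogroup_compatible_nap (K : fieldType) (L : gradedPreLieType K) :
  abelian_cogroup L -> compatible_nap L.
Proof.
case=> phi [[hphi coass p1 p2] _]; exists (codelta phi); split.
- by move=> n x /hphi /mcan_homog[].
- exact: codelta_nap.
- exact: codeltaM.
Qed.

(** * The operator mul Delta *)

Section Euler.
Variables (K : fieldType) (L : preLieType K) (D : {linear L -> tensor L L}).

Definition euler (x : L) : L := tmul (D x).
Fact euler_linear : linear euler.
Proof. by move=> c u v; rewrite /euler !linearP. Qed.
HB.instance Definition _ := GRing.isLinear.Build K L L *:%R euler euler_linear.

Definition lmul (y x : L) : L := y ∘ x.
Fact lmul_linear y : linear (lmul y).
Proof. by move=> c u v; apply: circPr. Qed.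
HB.instance Definition _ y := GRing.isLinear.Build K L L *:%R (lmul y) (lmul_linear y).

(** Multiplication of the last two factors, (a ⊗ b) ⊗ y being sent to a ⊗ (b ∘ y). *)
Definition mul23 : tensor (tensor L L) L -> tensor L L :=
  tlift (bil_of (@tmap_rmulr_bilinear K L L)).
HB.instance Definition _ := GRing.Linear.on mul23.
Lemma mul23_tens t y : mul23 (t ⊗ y) = tmap idfun (rmul y) t.
Proof. exact: tlift_tens. Qed.

Lemma mul12_tau23 (t : tensor L L) y :
  tmap (@tmul K L) idfun (tau23 (t ⊗ y)) = tmap (rmul y) idfun t.
Proof.
elim/tensor_ind: t => [|a b t IH]; first by rewrite tens0l tau230 !tmap0.
by rewrite tensDl tau23D !tmapD IH tau23_tens !tmap_tens /= tmul_tens.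
Qed.

(** On pure tensors this is the pre-Lie identity (a ∘ y) ∘ b + a ∘ (b ∘ y) = (a ∘ b) ∘ y + a ∘ (y ∘
    b). *)
Lemma tmul_tact y (t : tensor L L) :
  tmul (tact y t) = tmul t ∘ y + tmul (tmap idfun (lmul y) t).
Proof.
elim/tensor_ind: t => [|a b t IH]; first by rewrite !linear0 linear0l addr0.
have e : tmul (tact y (a ⊗ b)) = tmul (a ⊗ b) ∘ y + tmul (tmap idfun (lmul y) (a ⊗ b)).
  rewrite tact_tens tmap_tens linearD /= !tmul_tens /lmul.
  have := circ_prelie a b y => /eqP; rewrite subr_eq => /eqP ->.
  by rewrite addrAC subrK addrC.
rewrite tmapD 2!(linearD _ (a ⊗ b)) linearD /= e IH.
by rewrite [in RHS]linearD /= linearDl addrACA.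
Qed.

Hypothesis napD : nap_coproduct D.
Hypothesis DM : forall x y, D (x ∘ y) = x ⊗ y + tact y (D x).

(** The compatibility relation made linear in t: the two halves of the action become maps applied to
    (D ⊗ Id) t. *)
Lemma D_tmul t : D (tmul t) =
  t + tmap (@tmul K L) idfun (tau23 (tmap D idfun t)) + mul23 (tmap D idfun t).
Proof.
elim/tensor_ind: t => [|a b t IH].
  by rewrite !linear0 !addr0.
rewrite tmapD tau23D tmapD !linearD IH /= tmul_tens DM tactE tmap_tens mul12_tau23 mul23_tens.
by rewrite [RHS](AC ((2*2)*2)%AC ((1*(3*5))*(2*4*6))%AC).
Qed.

(** Permutativity erases [tau23] in [D_tmul] for t = D x, and the middle term turns into (E ⊗ Id) D
    x. *)
Lemma D_euler x :
  D (euler x) = D x + tmap euler idfun (D x) + mul23 (tmap D idfun (D x)).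
Proof.
rewrite /euler D_tmul.
have /eqP := napD x; rewrite subr_eq0 => /eqP <-; congr (_ + _ + _).
by rewrite tmap_comp.
Qed.

Lemma euler_circ x y :
  euler (x ∘ y) = x ∘ y + euler x ∘ y + tmul (tmap idfun (lmul y) (D x)).
Proof. by rewrite /euler DM linearD /= tmul_tens tmul_tact addrA. Qed.

(** Filtration by iterating D on left factors. Step 0 is zero, so step 1 is the kernel of D. *)
Fixpoint cofil n (x : L) : Prop :=
  if n is m.+1 then tspan (fun a _ => cofil m a) (D x) else x = 0.

Lemma cofil0 n : cofil n 0.
Proof. by case: n => //= n; rewrite linear0; apply: tspan0. Qed.

Lemma cofilP n c x y : cofil n x -> cofil n y -> cofil n (c *: x + y).
Proof.
case: n => [-> ->|n hx hy] /=; first by rewrite scaler0 addr0.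
by rewrite linearP; apply: tspanP.
Qed.

Lemma cofilS n x : cofil n x -> cofil n.+1 x.
Proof.
elim: n x => [x ->|n IH x] /=; first by rewrite linear0; apply: tspan0.
by apply: tspan_sub => a _; apply: IH.
Qed.

Lemma cofil_mono m n x : (m <= n)%N -> cofil m x -> cofil n x.
Proof.
move/subnK <-; elim: (n - m)%N => // k IH h; rewrite addSn.
by apply: cofilS; apply: IH.
Qed.

Lemma cofil1 x : cofil 1 x -> D x = 0.
Proof.
rewrite /= => h; apply: (tspan_lin (f := idfun) (Q := fun t => t = 0) _ _ _ h) => //.
  by move=> c u v -> ->; rewrite scaler0 addr0.
by move=> a b ->; apply: tens0l.
Qed.

(** E acts as n on step n+1 modulo step n. By [D_euler], D sends (E - (n+1)) x to ((E - n) ⊗ Id) D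
    x, lowered by induction, plus a term whose left factors are those of a second application of
    D. *)
Lemma cofil_euler n x : cofil n.+1 x -> cofil n (euler x - n%:R *: x).
Proof.
elim: n x => [x /cofil1 h|n IH x hx].
  by rewrite scale0r subr0 /euler h linear0.
have {}hx : tspan (fun a _ => cofil n.+1 a) (D x) by [].
rewrite /= linearB linearZ /= D_euler.
(* One copy of D x turns the eigenvalue n+1 on x into n on the left factors. *)
have -> : D x + tmap euler idfun (D x) + mul23 (tmap D idfun (D x)) - n.+1%:R *: D x
  = (tmap euler idfun (D x) - n%:R *: D x) + mul23 (tmap D idfun (D x)).
  rewrite -addn1 natrD scalerDl scale1r opprD.
  by rewrite (AC (3*2)%AC ((2*4*3)*(1*5))%AC) /= subrr addr0.
apply: tspanD.
  apply: (tspan_lin (f := tmap euler idfun \- (n%:R \*: idfun)) _ _ _ hx) => /=.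
  - exact: tspan0.
  - by move=> c u v; apply: tspanP.
  move=> a b /IH h; rewrite tmap_tens /=.
  have -> : euler a ⊗ b - n%:R *: (a ⊗ b) = (euler a - n%:R *: a) ⊗ b.
    by rewrite [RHS]linearBl /= linearZl_LR.
  exact: tspan_tens.
apply: (tspan_lin (f := mul23 \o tmap D idfun) _ _ _ hx) => /=.
- exact: tspan0.
- by move=> c u v; apply: tspanP.
move=> a b ha; rewrite tmap_tens mul23_tens.
apply: (tspan_lin (f := tmap idfun (rmul b)) _ _ _ ha).
- exact: tspan0.
- by move=> c u v; apply: tspanP.
by move=> u v hu; rewrite /= tmap_tens; apply: tspan_tens.
Qed.

Hypothesis char0 : [pchar K] =i pred0.

Lemma natS_neq0 n : n.+1%:R != 0 :> K.
Proof. by have /pcharf0P -> := char0. Qed.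

(** If E x = 0, then (E - n) x = - n x lies one step lower; dividing by n > 0 brings x down to step
    1. *)
Lemma euler_ker n x : cofil n x -> euler x = 0 -> D x = 0.
Proof.
move=> hx ex; elim: n hx => [->|[|n] IH hx]; first exact: linear0.
  exact: cofil1.
apply: IH; have := cofil_euler hx; rewrite ex sub0r -scaleNr => h.
rewrite -[x]scale1r -[1](mulVf (_ : - n.+1%:R != 0)) ?oppr_eq0 ?natS_neq0 //.
by rewrite -scalerA -[_ *: _]addr0; apply: cofilP => //; apply: cofil0.
Qed.

Lemma euler_of_ker x : D x = 0 -> euler x = 0.
Proof. by move=> h; rewrite /euler h linear0. Qed.

Definition im_euler x := exists z, x = euler z.
Lemma im_euler0 : im_euler 0.
Proof. by exists 0; rewrite linear0. Qed.
Lemma im_eulerP c x y : im_euler x -> im_euler y -> im_euler (c *: x + y).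
Proof. by move=> [u ->] [v ->]; exists (c *: u + v); rewrite linearP. Qed.
Lemma im_eulerB x y : im_euler x -> im_euler y -> im_euler (x - y).
Proof. by move=> hx hy; rewrite addrC -scaleN1r; apply: im_eulerP. Qed.

(** In [euler_circ], E x is n x modulo a lower step and the last term has left factors in a lower
    step; by induction (n+1) x ∘ y is in the image. *)
Lemma circ_im_euler n x y : cofil n x -> im_euler (x ∘ y).
Proof.
elim: n x y => [x y ->|n IH x y hx]; first by rewrite linear0l; apply: im_euler0.
have h : n.+1%:R *: (x ∘ y) =
    euler (x ∘ y) - (euler x - n%:R *: x) ∘ y - tmul (tmap idfun (lmul y) (D x)).
  rewrite euler_circ linearBl /= linearZl_LR /= opprB.
  rewrite [RHS](AC (3*2*1)%AC ((1*4)*(2*5)*(3*6))%AC) /= !subrr !addr0.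
  by rewrite -[X in X + _]scale1r -scalerDl -mulrS.
rewrite -[_ ∘ _]scale1r -(mulVf (natS_neq0 n)) -scalerA h -[_ *: _]addr0.
apply: im_eulerP; last exact: im_euler0.
apply: im_eulerB; [apply: im_eulerB|].
- by exists (x ∘ y).
- by apply: IH; apply: cofil_euler.
apply: (tspan_lin (f := @tmul K L \o tmap idfun (lmul y)) _ _ _ hx) => /=.
- exact: im_euler0.
- by move=> c u v; apply: im_eulerP.
by move=> a b ha; rewrite tmap_tens tmul_tens; apply: IH.
Qed.

(** Induction applies to (E - n) x, whose image under E is - n E x; dividing by n concludes, and n =
    0 is the kernel of D. *)
Lemma euler_semisimple n x : cofil n x -> euler (euler x) = 0 -> euler x = 0.
Proof.
elim: n x => [x -> _|n IH x hx e]; first exact: linear0.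
have ey : euler (euler x - n%:R *: x) = - (n%:R *: euler x).
  by rewrite linearB linearZ /= e sub0r.
have := IH _ (cofil_euler hx); rewrite ey linearN linearZ /= e scaler0 oppr0.
move=> /(_ erefl).
case: n {IH ey} hx => [/cofil1 h _|n _]; first exact: euler_of_ker.
move/eqP; rewrite oppr_eq0 scaler_eq0 (negPf (natS_neq0 n)) => /eqP //.
Qed.

(** The stable subspace S keeps both parts under control; it is later everything, the words of
    bounded length, or one degree. *)
Lemma euler_decomp (S : L -> Prop) n x :
  (forall c x y, S x -> S y -> S (c *: x + y)) -> (forall x, S x -> S (euler x)) ->
  cofil n x -> S x -> exists v z, [/\ S v, S z, euler v = 0 & x = v + euler z].
Proof.
move=> SP SE; elim: n x => [x -> S0|n IH x hx Sx].
  by exists 0, 0; rewrite !linear0 addr0.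
have S0 : S 0 by rewrite -[0](addNr x) -scaleN1r; apply: SP.
have SZ c u : S u -> S (c *: u) by move=> ?; rewrite -[_ *: _]addr0; apply: SP.
have SD u v : S u -> S v -> S (u + v).
  by move=> ? ?; rewrite -[u]scale1r; apply: SP.
case: n IH hx => [|n] IH hx.
  by exists x, 0; rewrite linear0 addr0; split=> //; apply/euler_of_ker/cofil1.
have [|v [z [Sv Sz ev e]]] := IH _ (cofil_euler hx).
  by rewrite -scaleNr addrC; apply: SP => //; apply: SE.
(* Solves (E - (n+1)) x = v + E z, obtained one step lower, for x. *)
exists (- n.+1%:R^-1 *: v), (n.+1%:R^-1 *: (x - z)); split.
- exact: SZ.
- by apply: (SZ); rewrite -scaleN1r; apply: SD => //; apply: SZ.
- by rewrite linearZ /= ev scaler0.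
rewrite linearZ linearB /= scaleNr -scalerN -scalerDr.
have -> : - v + (euler x - euler z) = n.+1%:R *: x.
  move/eqP: e; rewrite subr_eq => /eqP ->.
  by rewrite [LHS](AC (1*(3*1))%AC ((1*2)*(3*5)*4)%AC) /= addNr subrr !add0r.
by rewrite scalerA mulVf ?natS_neq0 // scale1r.
Qed.

End Euler.

(** * Freeness on the primitive elements *)

Section Primitives.
Variables (K : fieldType) (L : preLieType K) (D : {linear L -> tensor L L}).

Definition prim_pred : {pred L} := [pred x | euler D x == 0].
Fact prim_submod : submod_closed prim_pred.
Proof.
split=> [|c x y]; rewrite !inE ?linear0 // => /eqP ex /eqP ey.
by rewrite linearP /= ex ey scaler0 addr0.
Qed.
HB.instance Definition _ := GRing.isSubmodClosed.Build K L prim_pred prim_submod.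

Definition prim := {x : L | x \in prim_pred}.
HB.instance Definition _ := SubChoice.on prim.
HB.instance Definition _ := [SubChoice_isSubLmodule of prim by <:].

Lemma prim_euler (v : prim) : euler D (val v) = 0.
Proof. by case: v => x /= /eqP. Qed.

End Primitives.

(** * The splitting into ker E and im E as linear maps *)

Section Splitting.
Variables (K : fieldType) (char0 : [pchar K] =i pred0).
Variables (L : preLieType K) (D : {linear L -> tensor L L}).
Hypothesis napD : nap_coproduct D.
Hypothesis DM : forall x y, D (x ∘ y) = x ⊗ y + tact y (D x).
Hypothesis exhD : forall x, exists n, cofil D n x.

Local Notation E := (euler D).

Lemma euler_euler0 x : E (E x) = 0 -> E x = 0.
Proof. by have [n hn] := exhD x; apply: (euler_semisimple napD DM char0 hn). Qed.
Lemma euler0_D x : E x = 0 -> D x = 0.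
Proof. by have [n hn] := exhD x; apply: (euler_ker napD DM char0 hn). Qed.

(** Decomposing twice moves z into the image: if z = v' + E z' with E v' = 0, then E z = E (E z').
    Membership in the image makes the choice unique, hence linear in x. *)
Lemma split_exists x : exists z, im_euler D z /\ E (x - E z) = 0.
Proof.
have [n hn] := exhD x.
have [//|//|v [z [_ _ ev ex]]] := euler_decomp (S := fun _ => True) napD DM char0 _ _ hn I.
have [m hm] := exhD z.
have [//|//|v' [z' [_ _ ev' ez]]] := euler_decomp (S := fun _ => True) napD DM char0 _ _ hm I.
exists (E z'); split; first by exists z'.
have -> : E (E z') = E z by rewrite ez linearD /= ev' add0r.
by rewrite ex addrK.
Qed.

(** The difference is some E w killed by E twice; semisimplicity is applied twice. *)
Lemma split_unique x z1 z2 : im_euler D z1 -> im_euler D z2 ->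
  E (x - E z1) = 0 -> E (x - E z2) = 0 -> z1 = z2.
Proof.
move=> h1 h2 e1 e2; apply/eqP; rewrite -subr_eq0; apply/eqP.
have [w hw] := im_eulerB h1 h2; rewrite hw; apply: euler_euler0; rewrite -hw.
apply: euler_euler0.
have -> : E (z1 - z2) = (x - E z2) - (x - E z1).
  by rewrite opprB [RHS]addrC addrA subrK linearB.
by rewrite linearB /= e1 e2 subrr.
Qed.

Definition split_part x : L := projT1 (cid (split_exists x)).
Lemma split_part_im x : im_euler D (split_part x).
Proof. by rewrite /split_part; case: cid => z []. Qed.
Lemma split_partP x : E (x - E (split_part x)) = 0.
Proof. by rewrite /split_part; case: cid => z []. Qed.

Fact split_part_linear : linear split_part.
Proof.
move=> c x y; apply: (@split_unique (c *: x + y)).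
- exact: split_part_im.
- by apply: im_eulerP; apply: split_part_im.
- exact: split_partP.
have -> : c *: x + y - E (c *: split_part x + split_part y) =
    c *: (x - E (split_part x)) + (y - E (split_part y)).
  by rewrite linearP /= scalerBr opprD addrACA.
by rewrite linearP /= !split_partP scaler0 addr0.
Qed.
HB.instance Definition _ :=
  GRing.isLinear.Build K L L *:%R split_part split_part_linear.

Fact prim_part_subproof x : x - E (split_part x) \in prim_pred D.
Proof. by rewrite inE split_partP. Qed.
Definition prim_part x : prim D := Sub (x - E (split_part x)) (prim_part_subproof x).
Lemma val_prim_part x : val (prim_part x) = x - E (split_part x).
Proof. by []. Qed.
Fact prim_part_linear : linear prim_part.
Proof.
move=> c x y; apply: val_inj.
rewrite [RHS](linearP (val : prim D -> L)) [LHS]val_prim_part.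
by rewrite [X in E X]linearP [E (_ + _)]linearP /= scalerBr opprD addrACA.
Qed.
HB.instance Definition _ :=
  GRing.isLinear.Build K L (prim D) *:%R prim_part prim_part_linear.

End Splitting.

(** * The coproduct of a free pre-Lie algebra *)

Section FreeCoproduct.
Variables (K : fieldType) (V : lmodType K).
Local Notation F := (freePL V).

Fact idfunK : cancel (@idfun F) idfun. Proof. by []. Qed.
(** Obtained from the cogroup map of the free algebra, so permutativity and compatibility come from
    the cogroup results. *)
Definition fdelta : F -> tensor F F := codelta (free_phi idfunK idfunK).
HB.instance Definition _ := GRing.Linear.on fdelta.

Lemma fdelta_nap : nap_coproduct fdelta.
Proof.
apply: codelta_nap => x; [exact: free_phi_proj1|exact: free_phi_proj2|].
exact: free_phi_coassoc.
Qed.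

Lemma fdeltaM x y : fdelta (x ∘ y) = x ⊗ y + tact y (fdelta x).
Proof.
by apply: codeltaM => z; [exact: free_phi_proj1|exact: free_phi_proj2].
Qed.

Lemma fdelta_gen v : fdelta (fgen v) = 0.
Proof.
have /= e := free_phi_gen idfunK idfunK v.
rewrite /fdelta /codelta [X in mcan X]e !linearD /= mcan_inl mcan_inr.
by rewrite mfib_mleft mfib_mright addr0.
Qed.

End FreeCoproduct.

(** The left factors of D (x ∘ y) are x itself, those of D x, and the latter multiplied by y; only
    the step of x matters. *)
Lemma cofil_circ (K : fieldType) (L : preLieType K) (D : {linear L -> tensor L L})
    n x y : (forall x y, D (x ∘ y) = x ⊗ y + tact y (D x)) ->
  cofil D n x -> cofil D n.+1 (x ∘ y).
Proof.
move=> DM; elim: n x => [x ->|n IH x hx]; first by rewrite linear0l; apply: cofil0.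
have hx' : tspan (fun a _ => cofil D n a) (D x) by [].
rewrite /= DM; apply: tspanD; first exact: tspan_tens.
apply: (tspan_lin (f := tact y) _ _ _ hx') => [|c u v|a b ha].
- exact: tspan0.
- exact: tspanP.
rewrite /= tact_tens; apply: tspanD; apply: tspan_tens; first exact: IH.
exact: cofilS.
Qed.

(** * Word length in the free algebra, and its primitive elements *)

Section WordLength.
Variables (K : fieldType) (V : lmodType K).
Local Notation F := (freePL V).

Lemma cofil_fdelta (x : F) : exists n, cofil (@fdelta K V) n x.
Proof.
elim/freePL_ind: x => [v|c x y [m hx] [n hy]|x y [n hx] _].
- by exists 1%N; rewrite /= fdelta_gen; apply: tspan0.
- exists (maxn m n); apply: cofilP; first exact: cofil_mono (leq_maxl _ _) hx.
  exact: cofil_mono (leq_maxr _ _) hy.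
- by exists n.+1; apply: cofil_circ => //; apply: fdeltaM.
Qed.

Definition wle : nat -> F -> Prop :=
  gen_homog (fun n x => (0 < n)%N /\ exists v, x = fgen v).

Lemma wle0 n x : wle n x -> n = 0%N -> x = 0.
Proof.
elim=> {n x} [//|n c x y _ hx _ hy n0|n x [h _] n0|m n x y _ hx _ hy /eqP].
- by rewrite hx // hy // scaler0 addr0.
- by rewrite n0 in h.
by rewrite addn_eq0 => /andP[/eqP/hx-> _]; rewrite linear0l.
Qed.

Lemma wle_mono m n x : (m <= n)%N -> wle m x -> wle n x.
Proof.
move=> le_mn h; elim: h n le_mn => {m x} [m|m c x y _ hx _ hy|m x [h1 h2]|m n x y _ hx hy' hy] k le_mk.
- exact: gen_homog0.
- by apply: gen_homogP; [apply: hx|apply: hy].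
- by apply: gen_homog_gen; split=> //; apply: leq_trans le_mk.
(* The slack is given to the left factor. *)
rewrite -(subnK le_mk) addnA; apply: gen_homog_circ => //; apply: hx.
exact: leq_addl.
Qed.

Lemma wle_exists (x : F) : exists n, wle n x.
Proof.
elim/freePL_ind: x => [v|c x y [m hx] [n hy]|x y [m hx] [n hy]].
- by exists 1%N; apply: gen_homog_gen; split=> //; exists v.
- exists (maxn m n); apply: gen_homogP; first exact: wle_mono (leq_maxl _ _) hx.
  exact: wle_mono (leq_maxr _ _) hy.
- by exists (m + n)%N; apply: gen_homog_circ.
Qed.

Definition tens_wle n := tspan (fun a b : F =>
  exists i j, [/\ wle i a, wle j b & (i + j)%N = n]).

Lemma wle_fdelta n x : wle n x -> tens_wle n (fdelta x).
Proof.
elim=> {n x} [n|n c x y _ hx _ hy|n x [_ [v ->]]|m n x y hx tx hy _].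
- by rewrite linear0; apply: tspan0.
- by rewrite linearP; apply: tspanP.
- by rewrite fdelta_gen; apply: tspan0.
rewrite fdeltaM; apply: tspanD; first by apply: tspan_tens; exists m, n.
apply: (tspan_lin (f := tact y) _ _ _ tx) => [|c u v|a b [i [j [ha hb <-]]]].
- exact: tspan0.
- exact: tspanP.
rewrite /= tact_tens; apply: tspanD; apply: tspan_tens.
  by exists (i + n)%N, j; rewrite addnAC; split=> //; apply: gen_homog_circ.
by exists i, (j + n)%N; rewrite addnA; split=> //; apply: gen_homog_circ.
Qed.

Lemma wle_euler n x : wle n x -> wle n (euler (@fdelta K V) x).
Proof.
move/wle_fdelta => h.
apply: (tspan_lin (f := @tmul K F) _ _ _ h) => [|c u v|a b [i [j [ha hb <-]]]].
- exact: gen_homog0.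
- exact: gen_homogP.
by rewrite /= tmul_tens; apply: gen_homog_circ.
Qed.

Hypothesis char0 : [pchar K] =i pred0.

(** Every product is in the image of E by [circ_im_euler], so only generators survive outside it. *)
Lemma fdelta_decomp (x : F) : exists v z, x = fgen v + euler (@fdelta K V) z.
Proof.
elim/freePL_ind: x => [v|c x y [v [z ->]] [v' [z' ->]]|x y _ _].
- by exists v, 0; rewrite linear0 addr0.
- by exists (c *: v + v'), (c *: z + z'); rewrite !linearP /= scalerDr addrACA.
have [n hn] := cofil_fdelta x.
have [z ->] := circ_im_euler (@fdelta_nap K V) (@fdeltaM K V) char0 y hn.
by exists 0, z; rewrite linear0 add0r.
Qed.

Lemma euler_fgen v : euler (@fdelta K V) (fgen v) = 0.
Proof. by apply: euler_of_ker; apply: fdelta_gen. Qed.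

Lemma fdelta_ker (x : F) : euler (@fdelta K V) x = 0 -> exists v, x = fgen v.
Proof.
have [v [z ->]] := fdelta_decomp x.
rewrite linearD /= euler_fgen add0r.
move/(euler_euler0 char0 (@fdelta_nap K V) (@fdeltaM K V) cofil_fdelta) => ->.
by exists v; rewrite addr0.
Qed.

End WordLength.

(** * The morphism from the free algebra on the primitives, and its injectivity *)

Section Freeness.
Variables (K : fieldType) (char0 : [pchar K] =i pred0).
Variables (L : preLieType K) (D : {linear L -> tensor L L}).
Hypothesis napD : nap_coproduct D.
Hypothesis DM : forall x y, D (x ∘ y) = x ⊗ y + tact y (D x).
Hypothesis exhD : forall x, exists n, cofil D n x.

Local Notation V := (prim D).
Local Notation F := (freePL V).
Local Notation E := (euler D).
Local Notation q := (split_part char0 napD DM exhD).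

Definition prim_hom : F -> L := flift (val : V -> L).
HB.instance Definition _ := PreLieHom.on prim_hom.

Lemma prim_hom_gen v : prim_hom (fgen v) = val v.
Proof. exact: flift_gen. Qed.

(** Both coproducts vanish on primitive generators and obey the same product rule. *)
Lemma prim_hom_delta x : D (prim_hom x) = tmap prim_hom prim_hom (fdelta x).
Proof.
elim/freePL_ind: x => [v|c x y hx hy|x y hx _].
- rewrite prim_hom_gen fdelta_gen tmap0.
  by apply: (euler0_D char0 napD DM exhD); apply: prim_euler.
- by rewrite !linearP /= hx hy.
rewrite [prim_hom _]circM /= DM fdeltaM tmapD tmap_tens hx; congr (_ + _).
elim/tensor_ind: (fdelta x) => [|a b t IH]; first by rewrite !linear0.
rewrite tmapD !(linearD (tact _)) tmapD /= IH; congr (_ + _).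
rewrite tmap_tens !tact_tens tmapD !tmap_tens.
by congr (_ ⊗ _ + _ ⊗ _); rewrite /= circM.
Qed.

Lemma prim_hom_tmul t : tmul (tmap prim_hom prim_hom t) = prim_hom (tmul t).
Proof.
elim/tensor_ind: t => [|a b t IH]; first by rewrite tmap0 !(linear0 (@tmul _ _)) linear0.
by rewrite tmapD !(linearD (@tmul _ _)) linearD /= IH tmap_tens !tmul_tens circM.
Qed.

Lemma prim_hom_euler x : E (prim_hom x) = prim_hom (euler (@fdelta K V) x).
Proof. by rewrite /euler prim_hom_delta prim_hom_tmul. Qed.

Definition lift_step (p : {linear L -> F}) (x : L) : F :=
  fgen (prim_part char0 napD DM exhD x) + tmul (tmap p p (D (q x))).
Fact lift_step_linear p : linear (lift_step p).
Proof. by move=> c x y; rewrite /lift_step !linearP /= scalerDr addrACA. Qed.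
HB.instance Definition _ p :=
  GRing.isLinear.Build K L F *:%R (lift_step p) (lift_step_linear p).

(* A left inverse of [prim_hom] on words of length at most [n], obtained by
   reading x = e + E q, with e primitive, as e + tmul (D q). *)
Fixpoint lift n : {linear L -> F} :=
  if n is m.+1 then lift_step (lift m) else \0.

(** Any z in a decomposition of x differs from the chosen [split_part] by an element of ker E = ker
    D, so D forgets the choice. *)
Lemma D_split_part u z : D (q (val (u : V) + E z)) = D z.
Proof.
apply/eqP; rewrite eq_sym -subr_eq0 -linearB; apply/eqP.
apply: (euler0_D char0 napD DM exhD); apply: (euler_euler0 char0 napD DM exhD).
have := split_partP char0 napD DM exhD (val u + E z).
by rewrite -addrA linearD /= prim_euler add0r -linearB.
Qed.

Lemma prim_part_decomp u z : prim_part char0 napD DM exhD (val (u : V) + E z) = u.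
Proof.
by apply: val_inj; rewrite val_prim_part /euler D_split_part addrK.
Qed.

Lemma liftK n x : wle n x -> lift n (prim_hom x) = x.
Proof.
elim: n x => [x h|n IH x hx]; first by rewrite (wle0 h erefl) linear0.
have [m hm] := cofil_fdelta x.
(* Decomposing inside the words of length at most n+1 keeps z there too, which bounds the factors of
   [fdelta z]. *)
have [c u v hu hv|u|v [z [hv hz ev ->]]] :=
  euler_decomp (S := wle n.+1) (@fdelta_nap K V) (@fdeltaM K V) char0 _ _ hm hx.
- exact: gen_homogP.
- exact: wle_euler.
have [u ->] := fdelta_ker char0 ev.
rewrite linearD /= -prim_hom_euler prim_hom_gen.
rewrite /lift_step prim_part_decomp D_split_part prim_hom_delta; congr (_ + _).
rewrite [in RHS]/euler; congr tmul; rewrite tmap_comp.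
have ht := wle_fdelta hz.
apply/eqP; rewrite -subr_eq0; apply/eqP.
apply: (tspan_lin (f := tmap (lift n \o prim_hom) (lift n \o prim_hom) \- idfun)
  (Q := fun t => t = 0) _ _ _ ht) => //= [c a b -> ->|a b [i [j [ha hb ij]]]].
  by rewrite scaler0 addr0.
rewrite tmap_tens /=.
(* A factor of length 0 is zero; otherwise both lengths are positive with sum n+1, so both are at
   most n and induction applies. *)
case: i ha ij => [|i] ha ij.
  by rewrite (wle0 ha erefl) !linear0 !tens0l subrr.
case: j hb ij => [|j] hb ij.
  by rewrite (wle0 hb erefl) !linear0 !tens0r subrr.
rewrite !IH ?subrr //.
  by apply: wle_mono hb; rewrite -ltnS -ij addSn ltnS leq_addl.
by apply: wle_mono ha; rewrite -ltnS -ij addnS ltnS leq_addr.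
Qed.

Lemma prim_hom_inj : injective prim_hom.
Proof.
move=> x y e; apply/eqP; rewrite -subr_eq0.
have [n /liftK <-] := wle_exists (x - y).
by rewrite [prim_hom _]linearB /= e subrr linear0.
Qed.

End Freeness.

(** * The graded case: grading of the primitives, surjectivity, degrees *)

Section Graded.
Variables (K : fieldType) (char0 : [pchar K] =i pred0).
Variables (L : gradedPreLieType K) (D : {linear L -> tensor L L}).
Hypothesis homogD : forall n x, homog n x -> tens_homog n (D x).
Hypothesis napD : nap_coproduct D.
Hypothesis DM : forall x y, D (x ∘ y) = x ⊗ y + tact y (D x).

Lemma homog_euler n (x : L) : homog n x -> homog n (euler D x).
Proof.
move/homogD/tens_homogE => h.
apply: (tspan_lin (f := @tmul K L) _ _ _ h) => [|c u v|a b [i [j [ha hb <-]]]].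
- exact: homog0.
- exact: homogP.
by rewrite /= tmul_tens; apply: homog_circ.
Qed.

(** Connectedness makes right factors of D x of positive degree, so left factors have smaller degree
    than x. *)
Lemma homog_cofil n (x : L) : homog n x -> cofil D n x.
Proof.
elim/ltn_ind: n x => -[|n] IH x hx; first exact: homog_connected.
have /homogD/tens_homogE h := hx.
apply: (tspan_lin (f := idfun) _ _ _ h) => [|c u v|a b [i [[|j] [ha hb ij]]]] /=.
- exact: tspan0.
- exact: tspanP.
- by rewrite (homog_connected _ hb) tens0r; apply: tspan0.
apply: tspan_tens; rewrite addnS in ij; case: ij => ij.
have le_in : (i <= n)%N by rewrite -ij leq_addr.
exact: (cofil_mono le_in (IH _ le_in _ ha)).
Qed.

Lemma graded_cofil (x : L) : exists n, cofil D n x.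
Proof.
have [N [f [hf ->]]] := homog_span x; exists N.
elim: N => [|N IH]; first by rewrite big_ord0; apply: cofil0.
have := cofilP 1 (cofilS IH) (cofilS (homog_cofil (hf N))).
by rewrite scale1r big_ord_recr.
Qed.

Local Notation V := (prim D).

Definition prim_homog n (v : V) := homog n (val v).

Fact prim_homog_span (v : V) : exists N (f : nat -> V),
  (forall n, prim_homog n (f n)) /\ v = \sum_(n < N) f n.
Proof.
have [N [f [hf e]]] := homog_span (val v).
(* E preserves degrees, so it kills each homogeneous component of a primitive element. *)
have fker n : (n < N)%N -> f n \in prim_pred D.
  move=> nN; rewrite inE; apply/eqP.
  apply: (homog_indep N (euler D \o f) _ _ _ nN) => [k|]; first exact: homog_euler.
  by rewrite -[RHS](prim_euler v) e [RHS]linear_sum.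
(* Beyond N the vector [f n] need not be primitive; the default 0 replaces it. *)
exists N, (fun n => insubd (0 : V) (f n)); split=> [n|].
  by rewrite /prim_homog val_insubd; case: ifP => _ //; apply: homog0.
apply: val_inj; rewrite e [RHS](linear_sum (val : V -> L)); apply: eq_bigr => i _.
by rewrite /= val_insubd fker.
Qed.

Fact prim_homog_indep N (f : nat -> V) : (forall n, prim_homog n (f n)) ->
  \sum_(n < N) f n = 0 -> forall n, (n < N)%N -> f n = 0.
Proof.
move=> hf e n nN; apply: val_inj.
apply: (homog_indep N (fun k => val (f k)) _ _ _ nN) => //.
by rewrite -(linear_sum (val : V -> L)) e.
Qed.

Fact prim_homog0 n : prim_homog n 0. Proof. exact: homog0. Qed.
Fact prim_homogP n c x y : prim_homog n x -> prim_homog n y -> prim_homog n (c *: x + y).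
Proof. exact: homogP. Qed.
Fact prim_homog_connected x : prim_homog 0 x -> x = 0.
Proof. by move=> h; apply: val_inj; apply: homog_connected. Qed.

Definition graded_prim : posGradedType K := HB.pack V
  (isPosGraded.Build K V prim_homog0 prim_homogP prim_homog_connected
     prim_homog_span prim_homog_indep).

Local Notation fhomog := (@free_homog K graded_prim).
Local Notation primh := (@prim_hom K L D).

Lemma prim_hom_homog n (y : freePL V) : fhomog n y -> homog n (primh y).
Proof.
elim=> {n y} [n|n c x y _ hx _ hy|n x [v hv ->]|m n x y _ hx _ hy].
- by rewrite linear0; apply: homog0.
- by rewrite linearP; apply: homogP.
- by rewrite prim_hom_gen.
- by rewrite circM; apply: homog_circ.
Qed.

(** In x = v + E z, v is a generator and E z multiplies the factors of D z, which have smaller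
    degree and are lifted by induction. *)
Lemma prim_hom_surj n (x : L) : homog n x ->
  exists2 y : freePL V, fhomog n y & primh y = x.
Proof.
elim/ltn_ind: n x => n IH x hx.
have [c u w hu hw|w hw|v [z [hv hz ev ->]]] :=
  euler_decomp (S := @homog K L n) napD DM char0 _ _ (homog_cofil hx) hx.
- exact: homogP.
- exact: homog_euler.
have [y hy ey] : exists2 y : freePL V, fhomog n y & primh y = tmul (D z).
  have /homogD/tens_homogE h := hz.
  apply: (tspan_lin (f := @tmul K L)
    (Q := fun t => exists2 y : freePL V, fhomog n y & primh y = t) _ _ _ h).
  - by exists 0; [apply: gen_homog0|apply: linear0].
  - move=> c _ _ [y1 h1 <-] [y2 h2 <-]; exists (c *: y1 + y2); last exact: linearP.
    exact: gen_homogP.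
  (* A factor of degree 0 is zero and the product lifts to 0; otherwise both degrees are below n. *)
  move=> a b [[|i] [[|j] [ha hb ij]]]; rewrite /= tmul_tens.
  - exists 0; first exact: gen_homog0.
    by rewrite (homog_connected _ ha) linear0l linear0.
  - exists 0; first exact: gen_homog0.
    by rewrite (homog_connected _ ha) linear0l linear0.
  - exists 0; first exact: gen_homog0.
    by rewrite (homog_connected _ hb) linear0r linear0.
  have [|ya hya ea] := IH i.+1 _ a ha; first by rewrite -ij addnS ltnS leq_addr.
  have [|yb hyb eb] := IH j.+1 _ b hb; first by rewrite -ij addSn ltnS leq_addl.
  exists (ya ∘ yb); last by rewrite circM /= ea eb.
  by rewrite -ij; apply: gen_homog_circ.
have vprim : v \in prim_pred D by rewrite inE ev.
exists (fgen (Sub v vprim : V) + y); last by rewrite linearD /= prim_hom_gen ey.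
rewrite -[fgen _]scale1r; apply: gen_homogP => //.
by apply: gen_homog_gen; exists (Sub v vprim : V).
Qed.

Lemma prim_hom_bij : bijective primh.
Proof.
have surj x : exists y, primh y = x.
  have [N [f [hf ->]]] := homog_span x.
  elim: N => [|N [y ey]]; first by exists 0; rewrite big_ord0 linear0.
  have [z _ ez] := prim_hom_surj (hf N).
  by exists (y + z); rewrite big_ord_recr /= -ey -ez linearD.
have gP x := projT2 (cid (surj x)).
exists (fun x => projT1 (cid (surj x))) => [y|//].
exact: (prim_hom_inj char0 napD DM graded_cofil (gP _)).
Qed.

End Graded.

Lemma compatible_nap_free (K : fieldType) (L : gradedPreLieType K) :
  [pchar K] =i pred0 -> compatible_nap L -> graded_free L.
Proof.
move=> char0 [D [hD napD DM]].
exists (graded_prim hD), (@prim_hom K L D : preLieHom (freePL (prim D)) L); split.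
  exact: (prim_hom_bij char0 hD napD DM).
move=> n x; split; first exact: (prim_hom_homog (homogD := hD)).
(* Degrees are reflected: the homogeneous preimage given by surjectivity is x itself, by
   injectivity. *)
move/(prim_hom_surj char0 hD napD DM) => [y hy].
by move/(prim_hom_inj char0 napD DM (graded_cofil hD)) => <-.
Qed.

Theorem theorem5p3p3 (K : fieldType) (char0 : [pchar K] =i pred0)
    (L : gradedPreLieType K) :
  (compatible_nap L <-> graded_free L) /\
  (graded_free L <-> abelian_cogroup L).
Proof.
split; split.
- exact: compatible_nap_free.
- by move/free_abelian_cogroup/cogroup_compatible_nap.
- exact: free_abelian_cogroup.
- by move/cogroup_compatible_nap/(compatible_nap_free char0).
Qed.
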